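(* Let $(X_n)_{n\ge 0}$ be a (tenable) Pólya urn process with $s$ colours and real replacement matrix $R$, and suppose that the urn is balanced (with all row sums of $R$ equal to $m>0$), irreducible and small, so that, as $n\to\infty$, $$\frac{X_n-n\lambda_1 v_1}{\sqrt{n\log^\nu n}}\ \overset{\mathrm d}{\longrightarrow}\ N(0,\Sigma),$$ where $\lambda_1$, $v_1$, $\nu$ and the asymptotic covariance matrix $\Sigma$ are as described in the context. Let $w=(w_1,\dots,w_s)$ be any vector in $\mathbb R^s$ and let $Y_n:=\langle w,X_n\rangle=\sum_{i=1}^sw_iX_{ni}$. Then $\mathbb E Y_n=n\lambda_1\langle w,v_1\rangle+o\big((n\log^\nu n)^{1/2}\big)$ and $\operatorname{Var}Y_n=(\gamma+o(1))\,n\log^\nu n$, where $\gamma=w^t\Sigma w$. Moreover, if $\gamma\ne0$, then $$\frac{Y_n-\mathbb E Y_n}{\sqrt{\operatorname{Var}Y_n}}\ \overset{\mathrm d}{\longrightarrow}\ N(0,1)$$ with convergence of all moments.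
   Context: Pólya urn process (real version): $R=(r_{ij})_{i,j=1}^s$ is a real $s\times s$ matrix and $X_0\in[0,\infty)^s\setminus\{0\}$ is a deterministic vector. Given $X_n=(X_{n1},\dots,X_{ns})\in[0,\infty)^s\setminus\{0\}$, put $X_{n+1}=X_n+(r_{K1},\dots,r_{Ks})$, where the random index $K\in\{1,\dots,s\}$ has conditional distribution (given the past) $\mathbb P(K=k\mid X_n)=X_{nk}/\sum_{j=1}^sX_{nj}$. So $(X_n)$ is a Markov process. Tenability: the process is tenable if always $X_n\in[0,\infty)^s\setminus\{0\}$. Throughout it is assumed that for all $j,k\in\{1,\dots,s\}$: $r_{kj}\ge0$ if $j\ne k$; and either $r_{kk}\ge 0$, or $X_{0k}\mathbb Z+\sum_{i=1}^s r_{ik}\mathbb Z=r_{kk}\mathbb Z$. Balanced: all row sums of $R$ equal a constant $m$; it is assumed that $m>0$. Irreducible: the matrix $R$ is irreducible. Then $\lambda_1:=m$ is a simple eigenvalue of $R$, all other eigenvalues $\lambda$ satisfy $\operatorname{Re}\lambda<\lambda_1$, and there is a unique positive left eigenvector $v_1$ of $R$ with eigenvalue $\lambda_1$ and $|v_1|=1$, where $|(x_1,\dots,x_s)|:=\sum_i|x_i|$. Small: $\lambda_1$ is a simple eigenvalue and every other eigenvalue $\lambda$ of $R$ satisfies $\operatorname{Re}\lambda\le\frac12\lambda_1$. The urn is strictly small if all these inequalities are strict, and critically small if it is small but not strictly small. The exponent $\nu$: $\nu=0$ if the urn is strictly small; $\nu=2d+1$ if the urn is critically small, where $1+d$ ($d\ge0$)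 is the dimension of the largest Jordan block of $R$ corresponding to an eigenvalue $\lambda$ with $\operatorname{Re}\lambda=\lambda_1/2$. Notation: $\log^\nu n=(\log n)^\nu$. The matrix $\Sigma$: for a balanced irreducible small urn it is known that $(X_n-n\lambda_1v_1)/\sqrt{n\log^\nu n}$ converges in distribution to a centred normal distribution on $\mathbb R^s$; $\Sigma$ denotes the covariance matrix of this limit (it is determined by $R$). *)

(* Defs.v *)
From HB Require Import structures.
From mathcomp Require Export all_boot all_order all_algebra.
From mathcomp Require Export complex.
From mathcomp Require Export all_classical all_reals all_analysis.

Set Implicit Arguments.
Unset Strict Implicit.
Unset Printing Implicit Defensive.

Export Order.TTheory GRing.Theory Num.Theory.
Export numFieldNormedType.Exports.

#[global] Open Scope classical_set_scope.
#[global] Open Scope ring_scope.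

Definition dotv (R : realType) (s : nat) (u x : 'rV[R]_s) : R :=
  \sum_(i < s) u 0 i * x 0 i.

Definition nonneg_nonzero (R : realType) (s : nat) (x : 'rV[R]_s) : Prop :=
  (forall i, 0 <= x 0 i) /\ x != 0.

(* The past of [X] up to time [n] takes finitely many values, so conditioning
   on it amounts to conditioning on the trajectories [x 0, ..., x n]; the
   product form of the last clause gives no constraint on null trajectories.
   The drawn colour is [K n], and row [k] of [r] is what is added when [k] is
   drawn. *)
Record polya_urn (d : measure_display) (T : measurableType d) (R : realType)
    (P : probability T R) (s : nat) (r : 'M[R]_s) (x0 : 'rV[R]_s)
    (X : nat -> T -> 'rV[R]_s) (K : nat -> T -> 'I_s) : Prop := PolyaUrn {
  urn_start_nonneg : nonneg_nonzero x0;
  urn_start : forall t, X 0%N t = x0;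
  urn_step : forall n t, X n.+1 t = X n t + row (K n t) r;
  urn_draw_measurable : forall n k, measurable [set t | K n t = k];
  urn_draw : forall (n : nat) (x : nat -> 'rV[R]_s) (k : 'I_s),
    let past := [set t | forall i, (i <= n)%N -> X i t = x i] in
    P (past `&` [set t | K n t = k]) =
      (P past * (x n 0 k / \sum_(j < s) x n 0 j)%:E)%E
}.

Definition tenable (d : measure_display) (T : measurableType d) (R : realType)
    (P : probability T R) (s : nat) (X : nat -> T -> 'rV[R]_s) : Prop :=
  {ae P, forall t, forall n, nonneg_nonzero (X n t)}.

(* The second clause is the equality of additive subgroups of [R]
   x0_k Z + \sum_i r_ik Z = r_kk Z. *)
Definition tenability_condition (R : realType) (s : nat) (r : 'M[R]_s)
    (x0 : 'rV[R]_s) : Prop :=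
  (forall k j : 'I_s, j != k -> 0 <= r k j) /\
  (forall k : 'I_s, 0 <= r k k \/
     [set x0 0 k * a%:~R + \sum_(i < s) r i k * (z i)%:~R
        | a in [set: int] & z in [set: 'I_s -> int]] =
     [set r k k * b%:~R | b in [set: int]]).

Definition balanced (R : realType) (s : nat) (r : 'M[R]_s) (m : R) : Prop :=
  forall i : 'I_s, \sum_(j < s) r i j = m.

(* Strong connectedness of the directed graph of nonzero entries. *)
Definition irreducible_mx (R : realType) (s : nat) (r : 'M[R]_s) : Prop :=
  forall i j : 'I_s, connect [rel a b | r a b != 0] i j.

Definition complexify (R : realType) (s : nat) (r : 'M[R]_s) : 'M[R[i]]_s :=
  map_mx (real_complex R) r.

Definition simple_eigenvalue (F : fieldType) (s : nat) (A : 'M[F]_s) (a : F) :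
    Prop :=
  mup a (char_poly A) = 1%N.

Definition small_urn (R : realType) (s : nat) (r : 'M[R]_s) (lambda1 : R) :
    Prop :=
  simple_eigenvalue (complexify r) (real_complex R lambda1) /\
  (forall lambda : R[i], eigenvalue (complexify r) lambda ->
     lambda != (real_complex R lambda1) -> complex.Re lambda <= lambda1 / 2).

Definition strictly_small_urn (R : realType) (s : nat) (r : 'M[R]_s)
    (lambda1 : R) : Prop :=
  simple_eigenvalue (complexify r) (real_complex R lambda1) /\
  (forall lambda : R[i], eigenvalue (complexify r) lambda ->
     lambda != (real_complex R lambda1) -> complex.Re lambda < lambda1 / 2).

Definition critically_small_urn (R : realType) (s : nat) (r : 'M[R]_s)
    (lambda1 : R) : Prop :=
  small_urn r lambda1 /\ ~ strictly_small_urn r lambda1.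

Definition jordan_block (F : fieldType) (k : nat) (a : F) : 'M[F]_k :=
  \matrix_(i, j) (a *+ (i == j) + (i.+1 == j)%:R).

(* [A] is similar to the block diagonal matrix with Jordan blocks of size [p i]
   and eigenvalue [a i]; the two-sided inverse [V] of [U] forces
   [\sum_i p i = s]. *)
Definition jordan_form (F : fieldType) (s : nat) (A : 'M[F]_s) (b : nat)
    (p : 'I_b -> nat) (a : 'I_b -> F) : Prop :=
  (forall i, (0 < p i)%N) /\
  exists (U : 'M[F]_(s, \sum_(i < b) p i)) (V : 'M[F]_(\sum_(i < b) p i, s)),
    [/\ U *m V = 1%:M, V *m U = 1%:M &
        A = U *m (\mxdiag_(i < b) jordan_block (p i) (a i)) *m V].

Definition largest_critical_block (R : realType) (s : nat) (r : 'M[R]_s)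
    (lambda1 : R) (k : nat) : Prop :=
  exists (b : nat) (p : 'I_b -> nat) (a : 'I_b -> R[i]),
    jordan_form (complexify r) p a /\
    (\max_(i < b | complex.Re (a i) == (lambda1 / 2)%R) p i)%N = k.

Definition urn_exponent (R : realType) (s : nat) (r : 'M[R]_s) (lambda1 : R)
    (nu : nat) : Prop :=
  (strictly_small_urn r lambda1 /\ nu = 0%N) \/
  (critically_small_urn r lambda1 /\
   exists d : nat, largest_critical_block r lambda1 d.+1 /\ nu = d.*2.+1).

Definition nlog (R : realType) (nu n : nat) : R := n%:R * ln n%:R ^+ nu.

(* The library's [normal_prob] is not the point mass when the standard
   deviation vanishes, whence the case distinction. *)
Definition centred_normal_law (R : realType) (v : R) (B : set R) : \bar R :=
  if v == 0 then \d_(0 : R) B else normal_prob 0 (Num.sqrt v) B.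

(* Possibly degenerate: every linear functional is normal or constant. *)
Definition centred_normal_vector (d : measure_display) (T : measurableType d)
    (R : realType) (P : probability T R) (s : nat) (Z : T -> 'rV[R]_s)
    (Sigma : 'M[R]_s) : Prop :=
  [/\ forall i, measurable_fun [set: T] (fun t => Z t 0 i : R),
      forall u : 'rV[R]_s, exists2 v : R, 0 <= v &
        forall B : set R, measurable B ->
          P [set t | B (dotv u (Z t))] = centred_normal_law v B &
      forall i j, covariance P (fun t => Z t 0 i) (fun t => Z t 0 j) =
        (Sigma i j)%:E].

Definition cvg_in_distribution (E : topologicalType) (R : realType)
    (d : measure_display) (T : measurableType d) (P : probability T R)
    (Zn : nat -> T -> E)
    (d' : measure_display) (T' : measurableType d') (P' : probability T' R)
    (Z : T' -> E) : Prop :=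
  forall f : E -> R, continuous f -> bounded_fun f ->
    ('E_P[f \o Zn n] @[n --> \oo] --> 'E_P'[f \o Z])%E.

(* Main.v *)
Require Import Defs.
From mathcomp Require Import ring lra measurable_realfun.

(** Convergence in distribution of the rescaled urn is given, so the statement
    is about passing to the limit under expectations: it suffices to bound
    every even moment of (<w, X_n> - n m <w, v1>) / sqrt (n log^nu n) uniformly
    in n ([scaled_deviation_moments]); truncation then gives convergence of all
    moments ([moments_cvg]).

    The moment bounds come from a martingale with bounded increments.  The total
    mass S_n = S_0 + n m is deterministic.  Fix a final time t and a column u,
    and put c_t = u, c_k = (1 + r / S_k) c_{k+1} ([propag]).  Since the urn at
    time k draws colour i with probability X_{k,i} / S_k, the numbers X_k c_k
    form a martingale ending at X_t u, and each increment is a centred variable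
    bounded by a constant times |c_{k+1}|.  As in the Azuma-Hoeffding
    inequality, the exponential moments of X_t u - X_0 c_0 are then Gaussian
    with variance proxy sum_k |c_k|^2 ([urn_mgf]), and all even moments follow
    ([urn_even_moments]).

    It remains to see that sum_{k <= t} |c_k|^2 = O(t log^nu t), a statement
    about products of matrices.  It can only hold when v1 u = 0; a general w is
    reduced to u = w^T - <w, v1> 1, because the all-ones column is the right
    eigenvector for m and <1, X_t> = S_t is deterministic.  Let tau be the sum
    of the 1 / S_j for k <= j < t.  If u is annihilated by a product of l + 1
    factors r - z with Re z <= a, then |c_k| <= C e^{a tau} (1 + tau)^l
    ([propag_spectral]), while e^{m tau} is of order S_t / S_k.  For a < m / 2
    the squares add up to O(t) ([sum_subcritical]), and for a = m / 2 to
    O(t log^{2l+1} t) ([sum_critical]).  On the columns orthogonal to v1 the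
    eigenvalue m does not contribute ([top_generalized_eigen_eq0]), by a maximum
    principle for right eigenvectors ([eigen_top_const]).  A strictly small urn
    is then handled by Cayley-Hamilton, and a critically small one by decomposing
    u along a Jordan basis, in which the blocks with Re z = m / 2 have size at
    most d + 1.

    For the limit, the moment generating function exp (th^2 v / 2) of N(0, v)
    yields its mean and variance ([mgf_mean1], [mgf_mean2]); hence <w, Z> has
    law N(0, w Sigma w^T).  The standardized variables are affine images of the
    rescaled ones with convergent coefficients, and Slutsky's argument
    ([slutsky_affine]) concludes. *)

Set Implicit Arguments.
Unset Strict Implicit.
Unset Printing Implicit Defensive.
Import complex.ComplexField.Normc.

(** * Elementary inequalities *)

(** Because exp x = 1 / exp (- x) <= 1 / (1 - x); the constant 2 absorbs the
    tail of the geometric series on the half unit interval. *)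
Lemma expR_le1Dxx (R : realType) (x : R) :
  `|x| <= 1 / 2 -> expR x <= 1 + x + 2 * x ^+ 2.
Proof.
rewrite ler_norml => /andP[x_ge x_le].
have : 1 - x <= expR (- x) by rewrite expR_ge1Dx.
rewrite expRN => h.
have e0 := expR_gt0 x.
have {}h : (1 - x) * expR x <= 1.
  by rewrite -[leRHS](@mulVf _ (expR x)) ?gt_eqF// ler_wpM2r ?expR_ge0.
have p : 1 <= (1 - x) * (1 + x + 2 * x ^+ 2) by move: (sqr_ge0 x); nra.
have x1 : 0 < 1 - x by lra.
by rewrite -(ler_pM2l x1) (le_trans h).
Qed.

(** A converse to 1 + x <= exp x up to second order, from exp y <= 1 / (1 - y)
    and (1 - x + x^2) (1 + x) = 1 + x^3.  It compares products of factors 1 + m / S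
    with exponentials of sums. *)
Lemma expR_sub_sqr (R : realType) (x : R) :
  0 <= x -> expR (x - x ^+ 2) <= 1 + x.
Proof.
move=> x0.
have : 1 - (x - x ^+ 2) <= expR (- (x - x ^+ 2)) by rewrite expR_ge1Dx.
rewrite expRN => h.
have e0 := expR_gt0 (x - x ^+ 2).
have {}h : (1 - (x - x ^+ 2)) * expR (x - x ^+ 2) <= 1.
  by rewrite -[leRHS](@mulVf _ (expR (x - x ^+ 2))) ?gt_eqF// ler_wpM2r ?expR_ge0.
have p : 1 <= (1 - (x - x ^+ 2)) * (1 + x).
  have -> : (1 - (x - x ^+ 2)) * (1 + x) = 1 + x ^+ 3 by ring.
  by rewrite lerDl exprn_ge0.
have x1 : 0 < 1 - (x - x ^+ 2) by nra.
by rewrite -(ler_pM2l x1) (le_trans h).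
Qed.

(** Lets a small loss in the exponential rate absorb the polynomial factors
    produced by non-trivial Jordan blocks. *)
Lemma powD1_le_expR (R : realType) (N : nat) (e : R) : 0 < e ->
  exists2 c : R, 0 < c & forall y, 0 <= y -> (1 + y) ^+ N <= c * expR (e * y).
Proof.
move=> e0.
(* N + 1 rather than N keeps b positive when N = 0 *)
pose b : R := N.+1%:R / e.
have b0 : 0 < b by rewrite divr_gt0.
exists ((1 + b) ^+ N); first by rewrite exprn_gt0// ltr_wpDl// ltW.
move=> y y0.
have h1 : 1 + y <= (1 + b) * expR (y / b).
  apply: (@le_trans _ _ ((1 + b) * (1 + y / b))); last first.
    by rewrite ler_wpM2l ?expR_ge1Dx// addr_ge0 // ltW.
  have -> : (1 + b) * (1 + y / b) = 1 + y + (b + y / b) by field; rewrite gt_eqF.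
  by rewrite lerDl addr_ge0 ?divr_ge0 // ltW.
apply: (@le_trans _ _ (((1 + b) * expR (y / b)) ^+ N)).
  by apply: lerXn2r; rewrite ?nnegrE ?mulr_ge0 ?addr_ge0 ?expR_ge0 //; exact: ltW.
rewrite exprMn -expRM_natl ler_wpM2l ?exprn_ge0 ?addr_ge0//; first exact: ltW.
have -> : N%:R * (y / b) = e * y * (N%:R / N.+1%:R).
  by rewrite /b; field; rewrite !gt_eqF.
rewrite ler_expR ler_piMr ?mulr_ge0//; first exact: ltW.
by rewrite ler_pdivrMr// mul1r ler_nat.
Qed.

Lemma expR_ge1 (R : realType) (x : R) : 0 <= x -> 1 <= expR x.
Proof. by move=> x0; rewrite -expR0 ler_expR. Qed.

(** The first two terms of the binomial expansion; this is how the power of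
    1 + tau grows by one with each annihilating factor. *)
Lemma bernoulliD (R : realType) (x h : R) (l : nat) : 0 <= x -> 0 <= h ->
  x ^+ l + h * (l%:R * x ^+ l.-1) <= (x + h) ^+ l.
Proof.
move=> x0 h0; case: l => [|l]; first by rewrite mul0r mulr0 addr0.
elim: l => [|l IHl]; first by rewrite !expr1 expr0 !mulr1.
rewrite [leRHS]exprS; apply: le_trans (ler_wpM2l (addr_ge0 x0 h0) IHl).
rewrite -subr_ge0 /=.
have -> : (x + h) * (x ^+ l.+1 + h * (l.+1%:R * x ^+ l)) -
  (x ^+ l.+2 + h * (l.+2%:R * x ^+ l.+1)) = h ^+ 2 * (l.+1%:R * x ^+ l).
  by rewrite !exprS -(natr1 l.+1); ring.
by rewrite !mulr_ge0 ?exprn_ge0.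
Qed.

Lemma even_pow_norm (R : realType) (x : R) (q : nat) :
  x ^+ q.*2 = `|x| ^+ q.*2.
Proof. by rewrite -normrX ger0_norm// exprn_even_ge0 ?odd_double. Qed.

Lemma even_power_le_expR (R : realType) (x : R) (q : nat) :
  x ^+ q.*2 <= (q.*2)`!%:R * (expR x + expR (- x)).
Proof.
have f0 : 0 < (q.*2)`!%:R :> R by rewrite ltr0n fact_gt0.
have h : x ^+ q.*2 <= (q.*2)`!%:R * expR `|x|.
  case: q f0 => [|q] f0.
    by rewrite fact0 mul1r expr0 expR_ge1.
  have := @expR_ge1Dxn R `|x| q.*2.+1 (normr_ge0 _).
  rewrite -(ler_pM2l f0) => /(le_trans _); apply.
  rewrite mulrDr mulr1 -doubleS mulrCA divff ?gt_eqF// mulr1.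
  rewrite -normrX ger0_norm ?exprn_even_ge0 ?odd_double//.
  by rewrite lerDr ltW.
rewrite (le_trans h)// ler_wpM2l ?(ltW f0)//.
by have [x0|x0] := ler0P x; rewrite ?lerDl ?lerDr expR_ge0.
Qed.

Lemma even_powerD_le (R : realType) (a b : R) (q : nat) :
  (a + b) ^+ q.*2 <= 2 ^+ q.*2 * (a ^+ q.*2 + b ^+ q.*2).
Proof.
rewrite (even_pow_norm (a + b)) (even_pow_norm a) (even_pow_norm b).
pose M : R := Num.max `|a| `|b|.
have M0 : 0 <= M by rewrite le_max normr_ge0.
apply: (@le_trans _ _ ((2 * M) ^+ q.*2)).
  apply: lerXn2r; rewrite ?nnegrE ?mulr_ge0//.
  rewrite (le_trans (ler_normD _ _))// [2]mulr2n mulrDl !mul1r.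
  by rewrite lerD// le_max lexx ?orbT.
rewrite exprMn ler_wpM2l ?exprn_ge0//.
rewrite /M; case: (leP `|a| `|b|) => _; first by rewrite lerDr exprn_ge0.
by rewrite lerDl exprn_ge0.
Qed.

(** * The backward propagator *)

(** [propag A S k l u] is (1 + A / S k) ... (1 + A / S (k + l - 1)) u: the column
    at time k whose pairing with the urn is the conditional expectation, given the
    past up to time k, of its pairing with [u] at time k + l. *)
Fixpoint propag (F : fieldType) (s : nat) (A : 'M[F]_s) (S : nat -> F)
    (k l : nat) (u : 'cV[F]_s) : 'cV[F]_s :=
  if l is l'.+1 then
    let c := propag A S k.+1 l' u in c + (S k)^-1 *: (A *m c)
  else u.

Section propag.
Variables (F : fieldType) (s : nat) (A : 'M[F]_s) (S : nat -> F).

Lemma propagD k l u v :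
  propag A S k l (u + v) = propag A S k l u + propag A S k l v.
Proof.
elim: l k => //= l IH k.
by rewrite IH mulmxDr scalerDr addrACA.
Qed.

Lemma propagZ k l a u : propag A S k l (a *: u) = a *: propag A S k l u.
Proof.
elim: l k => //= l IH k; rewrite IH -scalemxAr scalerDr !scalerA.
by rewrite [a * _]mulrC.
Qed.

Lemma propag0 k l : propag A S k l 0 = 0.
Proof. by rewrite -[0 in LHS](scale0r (0 : 'cV_s)) propagZ scale0r. Qed.

Lemma propagM k l u : propag A S k l (A *m u) = A *m propag A S k l u.
Proof.
by elim: l k => //= l IH k; rewrite IH mulmxDr -scalemxAr.
Qed.

End propag.

Lemma map_propag (F K : fieldType) (f : {rmorphism F -> K}) (s : nat)
    (A : 'M[F]_s) S k l u :
  map_mx f (propag A S k l u) =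
  propag (map_mx f A) (fun j => f (S j)) k l (map_mx f u).
Proof.
elim: l k => //= l IH k.
by rewrite map_mxD map_mxZ map_mxM fmorphV IH.
Qed.

(** * Norm bounds from annihilating factors *)

(** The l^1 norm, with values in the real field rather than in its complexification
    where the library norm takes its values. *)
Definition cnorm (R : realType) (s : nat) (x : 'cV[R[i]]_s) : R :=
  \sum_(i < s) normc (x i 0).

Section cnorm.
Variables (R : realType) (s : nat).
Implicit Types x y : 'cV[R[i]]_s.

Lemma normc_ge0 (z : R[i]) : 0 <= normc z.
Proof. by case: z => a b; rewrite sqrtr_ge0. Qed.

Lemma cnorm_ge0 x : 0 <= cnorm x.
Proof. by apply: sumr_ge0 => i _; exact: normc_ge0. Qed.

Lemma cnormD x y : cnorm (x + y) <= cnorm x + cnorm y.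
Proof.
by rewrite -big_split ler_sum// => i _; rewrite mxE le_normcD.
Qed.

Lemma cnormZ a x : cnorm (a *: x) = normc a * cnorm x.
Proof. by rewrite mulr_sumr; apply: eq_bigr => i _; rewrite mxE normcM. Qed.

Lemma cnorm0 : cnorm (0 : 'cV[R[i]]_s) = 0.
Proof. by rewrite -[0 in LHS](scale0r (0 : 'cV_s)) cnormZ normc0 mul0r. Qed.

Lemma cnorm_ge_entry (x : 'cV[R]_s) i :
  `|x i 0| <= cnorm (map_mx (real_complex R) x).
Proof.
rewrite /cnorm (bigD1 i)//= mxE.
rewrite /= expr0n/= addr0 sqrtr_sqr lerDl.
by apply: sumr_ge0 => j _; exact: normc_ge0.
Qed.

End cnorm.

Lemma normcR (R : realType) (a : R) : 0 <= a -> normc (real_complex R a) = a.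
Proof. by move=> a0 /=; rewrite expr0n/= addr0 sqrtr_sqr ger0_norm. Qed.

(** After squaring, the claim is 1 + 2 Re z / S + |z|^2 / S^2 <=
    exp (2 Re z / S + |z|^2 / S^2).  The quadratic correction is summable along the
    product, so only the real part of an eigenvalue matters for the growth. *)
Lemma normc1Ddiv (R : realType) (z : R[i]) (S a : R) : 0 < S ->
  complex.Re z <= a ->
  normc (1 + real_complex R S^-1 * z) <=
    expR (a / S + normc z ^+ 2 * S^-1 ^+ 2).
Proof.
case: z => p q S0 /= pa; rewrite mul0r subr0 mul0r addr0 add0r.
set t := S^-1; have t0 : 0 < t by rewrite invr_gt0.
rewrite sqr_sqrtr ?addr_ge0 ?sqr_ge0//.
rewrite -[leRHS]ger0_norm ?expR_ge0// -sqrtr_sqr ler_wsqrtr//.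
have -> : (1 + t * p) ^+ 2 + (t * q) ^+ 2 =
  1 + (2 * p * t + (p ^+ 2 + q ^+ 2) * t ^+ 2) by ring.
rewrite (le_trans (expR_ge1Dx _))// -expRM_natl ler_expR.
have := mulr_ge0 (addr_ge0 (sqr_ge0 p) (sqr_ge0 q)) (sqr_ge0 t).
have := ler_wpM2r (ltW t0) pa.
by move: (_ * t ^+ 2) => w; nra.
Qed.

Definition tau (R : realType) (S : nat -> R) (k l : nat) : R :=
  \sum_(k <= j < k + l) (S j)^-1.

Definition tau2 (R : realType) (S : nat -> R) (k l : nat) : R :=
  \sum_(k <= j < k + l) (S j)^-1 ^+ 2.

Section tau.
Variables (R : realType) (S : nat -> R).
Hypothesis S_gt0 : forall j, 0 < S j.

Lemma tau0 k : tau S k 0 = 0.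
Proof. by rewrite /tau addn0 big_geq. Qed.

Lemma tau20 k : tau2 S k 0 = 0.
Proof. by rewrite /tau2 addn0 big_geq. Qed.

Lemma tauS k l : tau S k l.+1 = (S k)^-1 + tau S k.+1 l.
Proof. by rewrite /tau big_ltn ?addSnnS// -addSnnS ltnS leq_addr. Qed.

Lemma tau2S k l : tau2 S k l.+1 = (S k)^-1 ^+ 2 + tau2 S k.+1 l.
Proof. by rewrite /tau2 big_ltn ?addSnnS// -addSnnS ltnS leq_addr. Qed.

Lemma tau_ge0 k l : 0 <= tau S k l.
Proof. by apply: sumr_ge0 => j _; rewrite invr_ge0 ltW. Qed.

Lemma tau2_ge0 k l : 0 <= tau2 S k l.
Proof. by apply: sumr_ge0 => j _; rewrite sqr_ge0. Qed.

End tau.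

(** With u' = (A - z) u one has the scalar recursion
    c_k(u) = (1 + z / S_k) c_{k+1}(u) + c_{k+1}(u') / S_k, and u' is annihilated by
    one factor less.  Each factor thus costs one power of 1 + tau, the first one
    being free since then u' = 0. *)
Lemma propag_spectral (R : realType) (s : nat) (A : 'M[R[i]]_s.+1)
    (S : nat -> R) (D a : R)
    (S_gt0 : forall j, 0 < S j) (S_ge : forall j, S 0%N <= S j)
    (hD : forall k l, tau2 S k l <= D) :
  forall (L : seq R[i]) (l : nat) (u : 'cV[R[i]]_s.+1),
    (size L <= l.+1)%N -> (forall z, z \in L -> complex.Re z <= a) ->
    horner_mx A (\prod_(z <- L) ('X - z%:P)) *m u = 0 ->
  exists2 C : R, 0 <= C & forall k n,
    cnorm (propag A (fun j => real_complex R (S j)) k n u) <=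
      C * expR (a * tau S k n) * (1 + tau S k n) ^+ l.
Proof.
move=> L; elim: L => [|z L IH] l u sL ReL hu.
  exists 0 => // k n; move: hu; rewrite big_nil rmorph1 mul1mx => ->.
  by rewrite propag0 cnorm0 !mul0r.
pose P k n v := propag A (fun j => real_complex R (S j)) k n v.
pose u' := A *m u - z *: u.
have hu' : horner_mx A (\prod_(z <- L) ('X - z%:P)) *m u' = 0.
  move: hu; rewrite big_cons mulrC rmorphM/= -mulmxA.
  by rewrite rmorphB/= horner_mx_X horner_mx_C mulmxBl mul_scalar_mx.
have Ps k n : P k n.+1 u =
    (1 + real_complex R (S k)^-1 * z) *: P k.+1 n u +
    real_complex R (S k)^-1 *: P k.+1 n u'.
  rewrite /P /= -fmorphV /= -propagM (_ : A *m u = z *: u + u'); last first.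
    by rewrite /u' addrC subrK.
  by rewrite propagD propagZ scalerDr scalerA addrA scalerDl scale1r.
(* the factor l%:R makes the bound vanish with u' when only one factor is left *)
have [C' C'0 hC'] : exists2 C' : R, 0 <= C' & forall k n,
   cnorm (P k n u') <= C' * expR (a * tau S k n) * (l%:R * (1 + tau S k n) ^+ l.-1).
  case: l sL => [|l] sL.
    exists 0 => // k n; have /eqP : size L == 0%N by rewrite -leqn0.
    move/size0nil => L0; move: hu'; rewrite L0 big_nil rmorph1 mul1mx => ->.
    by rewrite /P propag0 cnorm0 !mul0r.
  have [|||C C0 hC] := IH l u'; rewrite //.
    by move=> y yL; apply: ReL; rewrite inE yL orbT.
  exists C => // k n; rewrite (le_trans (hC k n))//.
  rewrite ler_wpM2l ?mulr_ge0 ?expR_ge0//.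
  rewrite ler_peMl ?exprn_ge0 ?addr_ge0 ?tau_ge0//.
  by rewrite ler1n.
pose c0 := expR (`|a| / S 0%N).
pose C := cnorm u + c0 * C'.
have C0 : 0 <= C by rewrite addr_ge0 ?cnorm_ge0 ?mulr_ge0 ?expR_ge0.
pose Lam := normc z ^+ 2.
have Lam0 : 0 <= Lam by rewrite sqr_ge0.
suff h k n : cnorm (P k n u) <=
    C * expR (a * tau S k n + Lam * tau2 S k n) * (1 + tau S k n) ^+ l.
  exists (C * expR (Lam * D)); first by rewrite mulr_ge0 ?expR_ge0.
  move=> k n; rewrite (le_trans (h k n))// ler_wpM2r//.
    by rewrite exprn_ge0 ?addr_ge0 ?tau_ge0.
  rewrite -mulrA ler_wpM2l// -expRD ler_expR addrC lerD2r.
  by rewrite ler_wpM2l.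
elim: n k => [|n IHn] k.
  rewrite tau0 tau20 !mulr0 addr0 expR0 mulr1 addr0 expr1n mulr1 /P/=.
  by rewrite lerDl ?mulr_ge0 ?expR_ge0.
rewrite Ps (le_trans (cnormD _ _))// !cnormZ tauS tau2S.
have Sk := S_gt0 k; have iSk : 0 <= (S k)^-1 by rewrite invr_ge0 ltW.
rewrite [normc (real_complex R _)]normcR//.
set t := tau S k.+1 n; set t2 := tau2 S k.+1 n.
have t0 : 0 <= t by exact: tau_ge0.
set h := (S k)^-1 in iSk *.
pose E := expR (a * (h + t) + Lam * (h ^+ 2 + t2)).
have E0 : 0 <= E by exact: expR_ge0.
have bern : (1 + t) ^+ l + h * (l%:R * (1 + t) ^+ l.-1) <= (1 + (h + t)) ^+ l.
  by rewrite addrCA [X in _ <= X ^+ _]addrC bernoulliD ?addr_ge0.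
have b1 : normc (1 + real_complex R h * z) * cnorm (P k.+1 n u) <=
    C * E * (1 + t) ^+ l.
  have f1 := normc1Ddiv Sk (ReL z (mem_head _ _)).
  apply: le_trans (ler_pM (normc_ge0 _) (cnorm_ge0 _) f1 (IHn k.+1)) _.
  rewrite -/t -/t2 -/h -/Lam [C * _ * _]mulrC mulrCA [leRHS]mulrC.
  rewrite ler_wpM2l ?exprn_ge0 ?addr_ge0// mulrCA ler_wpM2l// -expRD ler_expR.
  by rewrite le_eqVlt; apply/orP; left; apply/eqP; ring.
have b2 : h * cnorm (P k.+1 n u') <= C * E * (h * (l%:R * (1 + t) ^+ l.-1)).
  rewrite mulrCA ler_wpM2l// (le_trans (hC' _ _))// -/t.
  rewrite ler_wpM2r ?mulr_ge0 ?exprn_ge0 ?addr_ge0//.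
  apply: (@le_trans _ _ ((c0 * C') * E)); last first.
    by rewrite ler_wpM2r// lerDr cnorm_ge0.
  rewrite [c0 * _]mulrC -mulrA ler_wpM2l// -expRD ler_expR.
  have : - (a * h) <= `|a| / S 0%N.
    apply: (@le_trans _ _ (`|a| * h)).
      by rewrite -mulNr ler_wpM2r// -normrN ler_norm.
    by rewrite ler_wpM2l// lef_pV2 ?posrE.
  have : 0 <= Lam * (h ^+ 2 + t2).
    by rewrite mulr_ge0// addr_ge0 ?sqr_ge0 ?tau2_ge0.
  by rewrite mulrDr; lra.
rewrite (le_trans (lerD b1 b2))// -mulrDr ler_wpM2l// mulr_ge0//.
Qed.

(** * Sums along a linearly growing total *)

Section total.
Variables (R : realType) (S0 m : R).
Hypotheses (S0_gt0 : 0 < S0) (m_gt0 : 0 < m).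
Let S (n : nat) : R := S0 + n%:R * m.

Lemma total_gt0 n : 0 < S n.
Proof. by rewrite ltr_wpDr// mulr_ge0// ltW. Qed.

Lemma totalS n : S n.+1 = S n + m.
Proof. by rewrite /S -natr1 mulrDl mul1r addrA. Qed.

Lemma total_ge n : S 0%N <= S n.
Proof. by rewrite /S mul0r addr0 lerDl mulr_ge0// ltW. Qed.

Let D := S0^-1 ^+ 2 + (m * S0)^-1.

(** Telescoping, since 1 / S_{j+1}^2 <= (1 / S_j - 1 / S_{j+1}) / m. *)
Lemma tau2_total_le k l : tau2 S k l <= D.
Proof.
suff h : tau2 S k l <= (S k)^-1 ^+ 2 + ((S k)^-1 - (S (k + l)%N)^-1) / m.
  rewrite (le_trans h)// lerD//.
    rewrite ler_pXn2r ?nnegrE ?invr_ge0 ?(ltW (total_gt0 _)) ?(ltW S0_gt0)//.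
    rewrite lef_pV2 ?posrE ?total_gt0//.
    by have := total_ge k; rewrite /S mul0r addr0.
  rewrite invfM mulrC ler_wpM2l ?invr_ge0 ?(ltW m_gt0)//.
  rewrite (@le_trans _ _ (S k)^-1)//.
    by rewrite gerBl invr_ge0 ltW ?total_gt0.
  rewrite lef_pV2 ?posrE ?total_gt0//.
  by have := total_ge k; rewrite /S mul0r addr0.
elim: l k => [|l IH] k.
  by rewrite tau20 addn0 subrr mul0r addr0 sqr_ge0.
rewrite tau2S lerD2l (le_trans (IH _))// addSnnS.
set c := (S (k + l.+1)%N)^-1.
have a0 := total_gt0 k; have b0 := total_gt0 k.+1.
rewrite totalS in b0 *; rewrite -subr_ge0.
have -> : ((S k)^-1 - c) / m - ((S k + m)^-1 ^+ 2 + ((S k + m)^-1 - c) / m) =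
   m / (S k * (S k + m) ^+ 2).
  by field; rewrite !gt_eqF.
by rewrite divr_ge0 ?mulr_ge0 ?sqr_ge0// ltW.
Qed.

(** The product of the 1 + m / S_j telescopes to S_{k+l} / S_k, and each factor
    is an exponential up to a summable error. *)
Lemma expR_tau_total k l :
  expR (m * tau S k l) <= expR (m ^+ 2 * D) * (S (k + l)%N / S k).
Proof.
suff h : expR (m * tau S k l) <=
    expR (m ^+ 2 * tau2 S k l) * (S (k + l)%N / S k).
  rewrite (le_trans h)// ler_wpM2r ?divr_ge0 ?(ltW (total_gt0 _))//.
  by rewrite ler_expR ler_wpM2l ?sqr_ge0 ?tau2_total_le.
elim: l k => [|l IH] k.
  by rewrite tau0 tau20 !mulr0 expR0 addn0 divff ?gt_eqF ?total_gt0// mulr1.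
rewrite tauS tau2S !mulrDr !expRD.
have a0 := total_gt0 k; have b0 := total_gt0 k.+1.
have : expR (m / S k) <= expR (m ^+ 2 * (S k)^-1 ^+ 2) * (S k.+1 / S k).
  have : 0 <= m / S k by rewrite divr_ge0 ?ltW.
  move/expR_sub_sqr; rewrite expRD expRN ler_pdivrMr ?expR_gt0//.
  rewrite exprMn => /le_trans; apply.
  rewrite [leRHS]mulrC ler_wpM2r ?expR_ge0// totalS.
  by rewrite mulrDl divff// gt_eqF.
move=> h; have := ler_pM (expR_ge0 _) (expR_ge0 _) h (IH k.+1).
rewrite addSnnS => /le_trans; apply.
rewrite le_eqVlt; apply/orP; left; apply/eqP.
by field; rewrite !gt_eqF.
Qed.

Lemma total_le_n : exists2 C : R, 0 < C & forall n, (0 < n)%N -> S n <= C * n%:R.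
Proof.
exists (S0 + m); first by rewrite addr_gt0.
move=> n n0; rewrite mulrDl /S [n%:R * m]mulrC lerD2r ler_peMr ?(ltW S0_gt0)//.
by rewrite ler1n.
Qed.

Lemma ln_ge_ln2 n : (1 < n)%N -> ln 2 <= ln n%:R :> R.
Proof. by move=> n1; rewrite ler_ln ?posrE ?ltr0n ?ler_nat ?(ltnW n1). Qed.

Lemma ln2_gt0 : 0 < ln 2 :> R.
Proof. by rewrite ln_gt0 ?ltr1n. Qed.

(** Read off from [expR_tau_total] by taking logarithms; 1 is absorbed in the
    logarithm from n = 2 on. *)
Lemma tau_total_le : exists2 C : R, 0 <= C &
  forall n, (1 < n)%N -> 1 + tau S 0 n <= C * ln n%:R.
Proof.
have [C1 C10 hC1] := total_le_n.
pose E := expR (m ^+ 2 * D) * (C1 / S0).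
have E0 : 0 < E by rewrite mulr_gt0 ?expR_gt0 ?divr_gt0.
exists ((1 + `|ln E| / m) / ln 2 + m^-1).
  by rewrite addr_ge0 ?divr_ge0 ?addr_ge0 ?invr_ge0 ?(ltW ln2_gt0) ?divr_ge0 ?(ltW m_gt0).
move=> n n1; have n0 : (0 < n)%N by rewrite ltnW.
have h : m * tau S 0 n <= ln E + ln n%:R.
  rewrite -lnM ?posrE ?ltr0n// -ler_expR lnK; last first.
    by rewrite posrE mulr_gt0// ltr0n.
  rewrite (le_trans (expR_tau_total _ _))// add0n /E -mulrA.
  rewrite ler_wpM2l ?expR_ge0// /S mul0r addr0 mulrAC.
  by rewrite ler_wpM2r ?invr_ge0 ?(ltW S0_gt0)// hC1.
have h1 : tau S 0 n <= `|ln E| / m + m^-1 * ln n%:R.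
  rewrite -(ler_pM2l m_gt0) mulrDr mulrCA divff ?gt_eqF// mulr1.
  rewrite mulrA divff ?gt_eqF// mul1r.
  by move: (ler_norm (ln E)) h; lra.
rewrite mulrDl; apply: le_trans (_ : _ <= 1 + (`|ln E| / m + m^-1 * ln n%:R)) _.
  by rewrite lerD2l.
rewrite addrA lerD2r -mulrA ler_peMr ?addr_ge0 ?divr_ge0 ?(ltW m_gt0)//.
by rewrite mulrC ler_pdivlMr ?ln2_gt0// mul1r ln_ge_ln2.
Qed.

Lemma tau_split k n : (k <= n)%N -> tau S k (n - k) <= tau S 0 n.
Proof.
move=> kn; rewrite /tau subnKC// add0n [leRHS](@big_cat_nat _ _ _ k)//=.
by rewrite lerDr sumr_ge0// => j _; rewrite invr_ge0 ltW// total_gt0.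
Qed.

(** At the critical rate the exponential contributes S_n / S_k to the square, so
    the sum over k is S_n times a harmonic sum, which is one more logarithm. *)
Lemma sum_critical (d : nat) (C : R) : 0 <= C -> exists2 C' : R, 0 <= C' &
  forall n, (1 < n)%N ->
    \sum_(k < n.+1) (C * expR (m / 2 * tau S k (n - k)) *
        (1 + tau S k (n - k)) ^+ d) ^+ 2 <= C' * nlog R d.*2.+1 n.
Proof.
move=> C0; have [C1 C10 hC1] := total_le_n.
have [C2 C20 hC2] := tau_total_le.
pose E := expR (m ^+ 2 * D); have E0 : 0 <= E := expR_ge0 _.
have c0 : 0 <= 1 + S0^-1 by rewrite addr_ge0// invr_ge0 ltW.
exists (C ^+ 2 * E * C1 * C2 ^+ (d.*2.+1) * (1 + S0^-1)).
  by rewrite !mulr_ge0 ?exprn_ge0// ltW.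
move=> n n1; have n0 : (0 < n)%N by rewrite ltnW.
set T := tau S 0 n; have T0 : 0 <= T by apply: tau_ge0; exact: total_gt0.
have term (k : 'I_n.+1) : (C * expR (m / 2 * tau S k (n - k)) *
        (1 + tau S k (n - k)) ^+ d) ^+ 2 <=
     C ^+ 2 * E * S n * (1 + T) ^+ d.*2 * (S k)^-1.
  have kn : (k <= n)%N by rewrite -ltnS.
  rewrite !exprMn -expRM_natl.
  have -> : 2%:R * (m / 2 * tau S k (n - k)) = m * tau S k (n - k) by field.
  rewrite -exprM muln2 -mulrA.
  have -> : C ^+ 2 * E * S n * (1 + T) ^+ d.*2 * (S k)^-1 =
     C ^+ 2 * (E * (S n / S k) * (1 + T) ^+ d.*2) by ring.
  rewrite ler_wpM2l ?sqr_ge0//.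
  have h1 := expR_tau_total k (n - k); rewrite subnKC// in h1.
  have t0 : 0 <= tau S k (n - k) by apply: tau_ge0; exact: total_gt0.
  have h2 : (1 + tau S k (n - k)) ^+ d.*2 <= (1 + T) ^+ d.*2.
    by apply: lerXn2r; rewrite ?nnegrE ?addr_ge0// lerD2l tau_split.
  exact: ler_pM (expR_ge0 _) (exprn_ge0 _ (addr_ge0 ler01 t0)) h1 h2.
have sumS : \sum_(k < n.+1) (S k)^-1 <= (1 + S0^-1) * (1 + T).
  rewrite big_ord_recr/= (_ : \sum_(i < n) _ = T); last first.
    by rewrite /T /tau add0n big_mkord.
  have : (S n)^-1 <= S0^-1.
    rewrite lef_pV2 ?posrE ?total_gt0//.
    by have := total_ge n; rewrite /S mul0r addr0.
  have i0 : 0 <= S0^-1 by rewrite invr_ge0 ltW.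
  have := mulr_ge0 i0 T0.
  by rewrite mulrDl mul1r mulrDr mulr1; lra.
apply: le_trans (ler_sum _ (fun k _ => term k)) _; rewrite -mulr_sumr.
have L0 : 0 <= ln n%:R :> R by rewrite ln_ge0 ?ler1n.
have pT : (1 + T) ^+ d.*2.+1 <= C2 ^+ d.*2.+1 * ln n%:R ^+ d.*2.+1.
  rewrite -exprMn; apply: lerXn2r; rewrite ?nnegrE ?addr_ge0 ?mulr_ge0//.
  exact: hC2.
have Sn0 : 0 <= S n by rewrite ltW ?total_gt0.
have pre0 : 0 <= C ^+ 2 * E * S n * (1 + T) ^+ d.*2.
  by rewrite mulr_ge0 ?exprn_ge0 ?addr_ge0// mulr_ge0// mulr_ge0 ?sqr_ge0.
apply: le_trans (ler_wpM2l pre0 sumS) _; rewrite /nlog.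
have := ler_pM Sn0 (exprn_ge0 _ (addr_ge0 ler01 T0)) (hC1 _ n0) pT.
have K0 : 0 <= C ^+ 2 * E * (1 + S0^-1) by rewrite !mulr_ge0 ?sqr_ge0.
move=> /(ler_wpM2l K0) => h.
rewrite [leLHS](_ : _ = C ^+ 2 * E * (1 + S0^-1) * (S n * (1 + T) ^+ d.*2.+1)).
  apply: le_trans h _.
  by rewrite le_eqVlt; apply/orP; left; apply/eqP; ring.
by rewrite [_ ^+ d.*2.+1]exprS; ring.
Qed.

(** After absorbing the polynomial factor, the sum V of the exp (b tau) with
    b < m satisfies V_{n+1} = exp (b / S_n) V_n + 1.  A multiple of S_n is a
    supersolution of this recursion up to factors 1 + O(1 / S_n^2), whose product
    converges. *)
Lemma sum_subcritical (l : nat) (a C : R) : a < m / 2 -> 0 <= C ->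
  exists2 C' : R, 0 <= C' &
  forall n, (0 < n)%N ->
    \sum_(k < n.+1) (C * expR (a * tau S k (n - k)) *
        (1 + tau S k (n - k)) ^+ l) ^+ 2 <= C' * n%:R.
Proof.
move=> am C0; have [C1 C10 hC1] := total_le_n.
pose b : R := Num.max (a + m / 2) (m / 2).
have bm : b < m.
  by rewrite gt_max; apply/andP; split; move: m_gt0 am => ? ?; lra.
have b_a : 2 * a < b by rewrite lt_max; apply/orP; left; lra.
have b0 : 0 < b by rewrite lt_max; apply/orP; right; rewrite divr_gt0.
have [|c c0 hc] := @powD1_le_expR R l.*2 (b - 2 * a); first by rewrite subr_gt0.
pose V n := \sum_(k < n.+1) expR (b * tau S k (n - k)).
have VS n : V n.+1 = expR (b / S n) * V n + 1.
  rewrite /V big_ord_recr/= subnn tau0 mulr0 expR0; congr (_ + 1).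
  rewrite mulr_sumr; apply: eq_bigr => k _; rewrite -expRD; congr expR.
  have kn : (k <= n)%N by rewrite -ltnS.
  rewrite -mulrDr; congr (_ * _).
  by rewrite /tau !subnKC ?(leqW kn)// big_nat_recr//= addrC.
(* the first term serves the initial value V 0 = 1, the second the increment 1 *)
pose Q := (S0^-1 + (m - b)^-1).
have Q0 : 0 < Q by rewrite addr_gt0 ?invr_gt0 ?subr_gt0.
have hV n : V n <= Q * S n * expR (b ^+ 2 * tau2 S 0 n).
  elim: n => [|n IH].
    rewrite /V big_ord1 subnn tau0 tau20 !mulr0 expR0 mulr1 /S mul0r addr0.
    by rewrite mulrDl mulVf ?gt_eqF// lerDl mulr_ge0 ?invr_ge0
      ?subr_ge0 ?(ltW bm) ?(ltW S0_gt0).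
  have Sn := total_gt0 n.
  have e1 : expR (b / S n) * S n <= (S n + b) * expR (b ^+ 2 * (S n)^-1 ^+ 2).
    have : 0 <= b / S n by rewrite divr_ge0 ?ltW.
    move/expR_sub_sqr; rewrite expRD expRN ler_pdivrMr ?expR_gt0// exprMn.
    move/(ler_wpM2r (ltW Sn))/le_trans; apply.
    by rewrite mulrAC mulrDl mul1r mulfVK ?gt_eqF.
  have e2 : 1 <= Q * (m - b).
    by rewrite mulrDl mulVf ?subr_eq0 ?gt_eqF// lerDr mulr_ge0 ?invr_ge0
      ?subr_ge0 ?(ltW bm) ?(ltW S0_gt0).
  have t2S : tau2 S 0 n.+1 = (S n)^-1 ^+ 2 + tau2 S 0 n.
    by rewrite /tau2 !add0n big_nat_recr//= addrC.
  rewrite VS t2S [b ^+ 2 * _]mulrDr [expR (_ + _)]expRD totalS.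
  set F := expR (b ^+ 2 * tau2 S 0 n); set G := expR (_ * (S n)^-1 ^+ 2).
  have F1 : 1 <= F by apply: expR_ge1; rewrite mulr_ge0 ?sqr_ge0 ?tau2_ge0.
  have G1 : 1 <= G by apply: expR_ge1; rewrite mulr_ge0 ?sqr_ge0.
  have FG1 : 1 <= G * F by rewrite mulr_ege1.
  have := ler_wpM2l (expR_ge0 (b / S n)) IH; rewrite -/F => h1.
  have QF0 : 0 <= Q * F by rewrite mulr_ge0 ?(ltW Q0) ?(le_trans ler01).
  have := ler_wpM2l QF0 e1; rewrite -/G => h2.
  have h3 : 1 <= Q * (m - b) * (G * F) by rewrite mulr_ege1.
  rewrite [leRHS](_ : _ = Q * F * ((S n + b) * G) + Q * (m - b) * (G * F)).
    rewrite lerD//; apply: le_trans h1 _; apply: le_trans h2.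
    by rewrite le_eqVlt; apply/orP; left; apply/eqP; ring.
  by ring.
exists (C ^+ 2 * c * (Q * C1 * expR (b ^+ 2 * D))).
  by rewrite !mulr_ge0 ?sqr_ge0 ?expR_ge0// ltW.
move=> n n0.
have term (k : 'I_n.+1) : (C * expR (a * tau S k (n - k)) *
        (1 + tau S k (n - k)) ^+ l) ^+ 2 <=
     C ^+ 2 * c * expR (b * tau S k (n - k)).
  rewrite !exprMn -expRM_natl -exprM muln2 -mulrA -[leRHS]mulrA.
  rewrite ler_wpM2l ?sqr_ge0//.
  have t0 : 0 <= tau S k (n - k) by apply: tau_ge0; exact: total_gt0.
  apply: le_trans (ler_wpM2l (expR_ge0 _) (hc _ t0)) _.
  rewrite mulrCA ler_wpM2l ?(ltW c0)// -expRD ler_expR.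
  by rewrite le_eqVlt; apply/orP; left; apply/eqP; ring.
apply: le_trans (ler_sum _ (fun k _ => term k)) _; rewrite -mulr_sumr -[leRHS]mulrA.
rewrite ler_wpM2l ?mulr_ge0 ?sqr_ge0 ?(ltW c0)//.
apply: le_trans (hV n) _.
rewrite -mulrA -2![leRHS]mulrA ler_wpM2l ?(ltW Q0)// [_ * n%:R]mulrC mulrA.
rewrite ler_pM ?expR_ge0 ?(ltW (total_gt0 _))// ?hC1//.
by rewrite ler_expR ler_wpM2l ?sqr_ge0// tau2_total_le.
Qed.

End total.

(** * Columns orthogonal to the leading left eigenvector *)

Lemma left_eigen_horner (F : comNzRingType) (n : nat) (A : 'M[F]_n.+1)
    (v : 'rV_n.+1) (a : F) (p : {poly F}) :
  v *m A = a *: v -> v *m horner_mx A p = p.[a] *: v.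
Proof.
move=> vA; elim/poly_ind: p => [|p c IH].
  by rewrite rmorph0 mulmx0 horner0 scale0r.
rewrite rmorphD rmorphM/= horner_mx_X horner_mx_C hornerMXaddC mulmxDr.
by rewrite mulmxA IH -scalemxAl vA mul_mx_scalar scalerA -scalerDl.
Qed.

Lemma right_eigen_horner (F : comNzRingType) (n : nat) (A : 'M[F]_n.+1)
    (v : 'cV_n.+1) (a : F) (p : {poly F}) :
  A *m v = a *: v -> horner_mx A p *m v = p.[a] *: v.
Proof.
move=> Av; elim/poly_ind: p => [|p c IH].
  by rewrite rmorph0 mul0mx horner0 scale0r.
rewrite rmorphD rmorphM/= horner_mx_X horner_mx_C hornerMXaddC mulmxDl.
by rewrite -mulmxA Av -scalemxAr IH mul_scalar_mx scalerA -scalerDl mulrC.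
Qed.

(** At a coordinate l where y is maximal, the sum of the r_lj (y_l - y_j) vanishes
    and has nonnegative terms; so y is maximal at every neighbour of l, and by
    irreducibility everywhere. *)
Lemma eigen_top_const (R : realType) (n : nat) (r : 'M[R]_n) (m : R)
    (y : 'cV[R]_n) :
  (forall k j, j != k -> 0 <= r k j) -> balanced r m -> irreducible_mx r ->
  r *m y = m *: y -> forall i j, y i 0 = y j 0.
Proof.
move=> r_ge0 hbal hirr ry.
move=> i; suff [i0 hi0] : exists i0, forall j, y j 0 = y i0 0.
  by move=> j; rewrite hi0 [RHS]hi0.
pose i0 := [arg max_(k > i) y k 0]%O.
have i0max j : y j 0 <= y i0 0.
  by rewrite /i0; case: arg_maxP => // k _ /(_ j isT).
exists i0 => j; have /connectP[p] := hirr i0 j.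
elim/last_ind: p j => [|p k IH] j; first by move=> _ ->.
rewrite rcons_path last_rcons => /andP[pp rk] ->.
have yl := IH _ pp erefl; set l := last i0 p in rk yl.
have [-> //|kl] := eqVneq k l.
have : \sum_j r l j * (y l 0 - y j 0) = 0.
  under eq_bigr do rewrite mulrBr.
  rewrite sumrB -mulr_suml hbal.
  by have /matrixP/(_ l 0) := ry; rewrite !mxE => ->; rewrite subrr.
move/eqP; rewrite psumr_eq0; last first.
  move=> q _; have [->|ql] := eqVneq q l; first by rewrite subrr mulr0.
  by rewrite mulr_ge0 ?r_ge0// subr_ge0 yl.
move/allP/(_ k); rewrite mem_index_enum => /(_ isT).
by rewrite mulf_eq0 (negbTE rk)/= subr_eq0 => /eqP <-.
Qed.

Lemma col_mul_jordan (F : fieldType) (n q : nat) (M : 'M[F]_(n, q)) (a : F)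
    (k : 'I_q) :
  col k (M *m jordan_block q a) = a *: col k M + \sum_(l < q | l.+1 == k) col l M.
Proof.
apply/colP => x; rewrite !mxE summxE.
under eq_bigr do rewrite mxE mulrDr.
rewrite big_split/=; congr (_ + _).
  rewrite (bigD1 k)//= eqxx mulr1n mulrC big1 ?addr0// => l lk.
  by rewrite (negbTE lk) mulr0n mulr0.
rewrite [RHS]big_mkcond/=; apply: eq_bigr => l _.
by case: eqP => _; rewrite ?mulr1 ?mulr0// mxE.
Qed.

Section decomposition.
Variables (R : realType) (n : nat) (r : 'M[R]_n.+1) (m : R) (v1 : 'rV[R]_n.+1).
Hypothesis r_ge0 : forall k j : 'I_n.+1, j != k -> 0 <= r k j.
Hypotheses (hbal : balanced r m) (hirr : irreducible_mx r).
Hypotheses (hv1 : v1 *m r = m *: v1) (v1_sum : \sum_i v1 0 i = 1).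

Let A := complexify r.
Let mC := real_complex R m.
Let v := map_mx (real_complex R) v1.

Let vA : v *m A = mC *: v.
Proof. by rewrite /v /A /complexify -map_mxM hv1 map_mxZ. Qed.

(** The matrix is real, so the real and imaginary parts of y are eigenvectors. *)
Lemma complex_eigen_top_const (y : 'cV[R[i]]_n.+1) : A *m y = mC *: y ->
  forall i j, y i 0 = y j 0.
Proof.
move=> Ay i j.
have sumRe (q : seq 'I_n.+1) (f : 'I_n.+1 -> R[i]) :
    complex.Re (\sum_(k <- q) f k) = \sum_(k <- q) complex.Re (f k).
  by elim: q => [|k q IH]; rewrite ?big_nil// !big_cons -IH; case: (f k);
    case: (bigop _ _ _).
have sumIm (q : seq 'I_n.+1) (f : 'I_n.+1 -> R[i]) :
    complex.Im (\sum_(k <- q) f k) = \sum_(k <- q) complex.Im (f k).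
  by elim: q => [|k q IH]; rewrite ?big_nil// !big_cons -IH; case: (f k);
    case: (bigop _ _ _).
have ReM a z : complex.Re (real_complex R a * z) = a * complex.Re z.
  by case: z => p q /=; rewrite mul0r subr0.
have ImM a z : complex.Im (real_complex R a * z) = a * complex.Im z.
  by case: z => p q /=; rewrite mul0r addr0.
pose yr : 'cV[R]_n.+1 := \col_i complex.Re (y i 0).
pose yi : 'cV[R]_n.+1 := \col_i complex.Im (y i 0).
have hr : r *m yr = m *: yr.
  apply/colP => k; have /matrixP/(_ k 0) := Ay.
  rewrite !mxE => /(congr1 (@complex.Re R)); rewrite ReM sumRe => <-.
  by apply: eq_bigr => l _; rewrite !mxE ReM.
have hi : r *m yi = m *: yi.
  apply/colP => k; have /matrixP/(_ k 0) := Ay.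
  rewrite !mxE => /(congr1 (@complex.Im R)); rewrite ImM sumIm => <-.
  by apply: eq_bigr => l _; rewrite !mxE ImM.
have := eigen_top_const r_ge0 hbal hirr hr i j.
have := eigen_top_const r_ge0 hbal hirr hi i j.
by rewrite !mxE; case: (y i 0) => ? ?; case: (y j 0) => ? ? /= -> ->.
Qed.

(** No generalized eigenvector for m is orthogonal to v1: by induction on the
    exponent (A - m) y vanishes, so y is constant, and v1 y is that constant. *)
Lemma top_generalized_eigen_eq0 (p : nat) (y : 'cV[R[i]]_n.+1) :
  v *m y = 0 -> horner_mx A (('X - mC%:P) ^+ p) *m y = 0 -> y = 0.
Proof.
elim: p y => [|p IH] y vy; first by rewrite expr0 rmorph1 mul1mx.
rewrite exprSr rmorphM/= -mulmxA.
have EX : horner_mx A ('X - mC%:P) *m y = A *m y - mC *: y.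
  by rewrite rmorphB/= horner_mx_X horner_mx_C mulmxBl mul_scalar_mx.
move/IH; rewrite EX mulmxBr -scalemxAr mulmxA vA -scalemxAl vy !scaler0 subr0.
move=> /(_ erefl)/eqP; rewrite subr_eq0 => /eqP /complex_eigen_top_const yc.
move/matrixP/(_ 0 0): vy; rewrite !mxE.
under eq_bigr do rewrite (yc _ 0) mxE.
rewrite -mulr_suml -rmorph_sum v1_sum rmorph1 mul1r => y0.
by apply/colP => k; rewrite (yc k 0) y0 mxE.
Qed.

Let ones : 'cV[R[i]]_n.+1 := const_mx 1.

Let vones : v *m ones = 1.
Proof.
apply/matrixP => i j; rewrite !ord1 !mxE/=.
under eq_bigr do rewrite !mxE mulr1.
by rewrite -rmorph_sum v1_sum rmorph1.
Qed.

Let Aones : A *m ones = mC *: ones.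
Proof.
apply/colP => i; rewrite !mxE mulr1.
under eq_bigr do rewrite !mxE mulr1.
by rewrite -rmorph_sum hbal.
Qed.

Section bound.
Variables (S0 : R) (nu : nat).
Hypotheses (S0_gt0 : 0 < S0) (m_gt0 : 0 < m).
Let S k : R := S0 + k%:R * m.
Let P k l u := propag A (fun j => real_complex R (S j)) k l u.

(** The bound sought for the columns orthogonal to v1; it defines a linear subspace,
    so that it can be checked on a basis. *)
Definition controlled (u : 'cV[R[i]]_n.+1) : Prop :=
  exists2 C : R, 0 <= C & forall t, (1 < t)%N ->
    \sum_(k < t.+1) cnorm (P k (t - k) u) ^+ 2 <= C * nlog R nu t.

Lemma controlledD u w : controlled u -> controlled w -> controlled (u + w).
Proof.
move=> [C C0 hC] [C' C'0 hC']; exists (2 * C + 2 * C').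
  by rewrite addr_ge0 ?mulr_ge0.
move=> t t1; rewrite mulrDl -2!mulrA.
apply: le_trans (lerD (ler_wpM2l _ (hC t t1)) (ler_wpM2l _ (hC' t t1))) => //.
rewrite !mulr_sumr -big_split/= ler_sum// => k _.
rewrite /P propagD; set a := propag _ _ _ _ u; set b := propag _ _ _ _ w.
have := cnormD a b; have := cnorm_ge0 (a + b).
have := cnorm_ge0 a; have := cnorm_ge0 b.
move: (cnorm (a + b)) (cnorm a) (cnorm b) => x y z z0 y0 x0 h.
have h2 : x ^+ 2 <= (y + z) ^+ 2.
  by apply: lerXn2r; rewrite ?nnegrE ?addr_ge0.
by have := sqr_ge0 (y - z); nra.
Qed.

Lemma controlledZ a u : controlled u -> controlled (a *: u).
Proof.
move=> [C C0 hC]; exists (normc a ^+ 2 * C); first by rewrite mulr_ge0 ?sqr_ge0.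
move=> t t1; rewrite -mulrA.
apply: le_trans (ler_wpM2l (sqr_ge0 _) (hC t t1)).
by rewrite mulr_sumr ler_sum// => k _; rewrite /P propagZ cnormZ exprMn.
Qed.

Lemma controlled0 : controlled 0.
Proof.
exists 0 => // t _; rewrite mul0r big1// => k _.
by rewrite /P propag0 cnorm0 expr0n.
Qed.

Lemma controlled_sum (I : Type) (q : seq I) (f : I -> 'cV_n.+1) :
  (forall i, controlled (f i)) -> controlled (\sum_(i <- q) f i).
Proof.
by move=> hf; apply: big_ind => //; [exact: controlled0|exact: controlledD].
Qed.

Lemma controlled_roots (L : seq R[i]) (a : R) (l : nat) u :
  (size L <= l.+1)%N -> (forall z, z \in L -> complex.Re z <= a) ->
  a < m / 2 \/ (a = m / 2 /\ nu = l.*2.+1) ->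
  horner_mx A (\prod_(z <- L) ('X - z%:P)) *m u = 0 -> controlled u.
Proof.
move=> sL ReL ha hu.
have Sgt0 := total_gt0 S0_gt0 m_gt0.
have [C C0 hC] := propag_spectral Sgt0 (total_ge S0 m_gt0)
  (tau2_total_le S0_gt0 m_gt0) sL ReL hu.
have h t : \sum_(k < t.+1) cnorm (P k (t - k) u) ^+ 2 <=
    \sum_(k < t.+1) (C * expR (a * tau S k (t - k)) *
        (1 + tau S k (t - k)) ^+ l) ^+ 2.
  apply: ler_sum => k _; apply: lerXn2r; last exact: hC.
    by rewrite nnegrE cnorm_ge0.
  rewrite nnegrE !mulr_ge0 ?expR_ge0 ?exprn_ge0 ?addr_ge0//.
  by apply: tau_ge0.
case: ha => [am|[am nuE]]; last first.
  have [C' C'0 hC'] := sum_critical S0_gt0 m_gt0 l C0.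
  exists C' => // t t1; apply: le_trans (h t) _.
  by rewrite nuE am; exact: hC'.
have [C' C'0 hC'] := sum_subcritical S0_gt0 m_gt0 l am C0.
exists (C' / ln 2 ^+ nu).
  by rewrite divr_ge0// exprn_ge0// ltW// ln2_gt0.
move=> t t1; have t0 : (0 < t)%N by rewrite ltnW.
apply: le_trans (h t) _; apply: le_trans (hC' t t0) _.
have L2 : 0 < ln 2 ^+ nu :> R by rewrite exprn_gt0// ln2_gt0.
rewrite /nlog -mulrA ler_wpM2l// mulrCA ler_peMr//.
rewrite mulrC ler_pdivlMr// mul1r; apply: lerXn2r; rewrite ?nnegrE.
- by rewrite ltW// ln2_gt0.
- by rewrite ln_ge0// ler1n.
- exact: ln_ge_ln2.
Qed.

(** The characteristic polynomial annihilates u.  Its factors X - m can be dropped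
    by [top_generalized_eigen_eq0], and the remaining finitely many roots stay away
    from the critical line. *)
Lemma controlled_strict u :
  (forall lambda : R[i], eigenvalue A lambda -> lambda != mC ->
     complex.Re lambda < m / 2) ->
  v *m u = 0 -> controlled u.
Proof.
move=> hs vu.
have [L hL] := closed_field_poly_normal (char_poly A).
move: hL; rewrite (monicP (char_poly_monic A)) scale1r => hL.
pose L' := [seq z <- L | z != mC].
have Re_lt z : z \in L' -> complex.Re z < m / 2.
  rewrite mem_filter => /andP[zm zL]; apply: hs => //.
  by rewrite eigenvalue_root_char hL root_prod_XsubC.
have [a am Re_le] : exists2 a, a < m / 2 &
    forall z, z \in L' -> complex.Re z <= a.
  elim: L' Re_lt => [|z q IH] h.
    by exists 0 => //; rewrite divr_gt0.
  have [|a am ha] := IH; first by move=> y yq; apply: h; rewrite inE yq orbT.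
  exists (Num.max a (complex.Re z)).
    by rewrite gt_max am h ?mem_head.
  move=> y; rewrite inE => /orP[/eqP->|/ha ya]; rewrite le_max ?lexx ?orbT//.
  by rewrite ya.
apply: (@controlled_roots L' a (size L')) => //; first by left.
have : horner_mx A (char_poly A) *m u = 0 by rewrite Cayley_Hamilton mul0mx.
rewrite hL (bigID (fun z => z == mC))/= rmorphM/= -mulmxA big_filter.
set Q := \prod_(i <- L | i != mC) _.
rewrite (eq_bigr (fun=> 'X - mC%:P)) => [|z /eqP->//].
rewrite big_const_seq iter_mulr_1; apply: top_generalized_eigen_eq0.
by rewrite mulmxA (left_eigen_horner _ vA) -scalemxAl vu scaler0.
Qed.

(** The vector subtracted is the projection of x on the all-ones eigenvector along the
    orthogonal of v1.  It is zero for z <> m, and equal to x for z = m; in both cases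
    what is left is annihilated by the same power of A - z. *)
Lemma controlled_generalized (d p : nat) (z : R[i]) x :
  (forall lambda : R[i], eigenvalue A lambda -> lambda != mC ->
     complex.Re lambda <= m / 2) ->
  nu = d.*2.+1 -> (0 < p)%N ->
  (complex.Re z = m / 2 -> (p <= d.+1)%N) ->
  horner_mx A (('X - z%:P) ^+ p) *m x = 0 ->
  controlled (x - (v *m x) 0 0 *: ones).
Proof.
move=> hs nuE p0 pd hx; set e := x - _.
have ve : v *m e = 0.
  rewrite mulmxBr -scalemxAr vones; move: (v *m x) => w.
  by apply/matrixP => i j; rewrite !ord1 !mxE mulr1 subrr.
have he : horner_mx A (('X - z%:P) ^+ p) *m e = 0.
  rewrite mulmxBr hx sub0r -scalemxAr (right_eigen_horner _ Aones).
  have [zm|zm] := eqVneq z mC.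
    by rewrite !hornerE zm subrr expr0n eqn0Ngt p0 scale0r scaler0 oppr0.
  have : v *m (horner_mx A (('X - z%:P) ^+ p) *m x) = 0 by rewrite hx mulmx0.
  rewrite mulmxA (left_eigen_horner _ vA) -scalemxAl => /eqP.
  rewrite scalemx_eq0 !hornerE expf_eq0 p0/= subr_eq0 eq_sym (negbTE zm)/=.
  by move=> /eqP ->; rewrite mxE scale0r oppr0.
have [->|e0] := eqVneq e 0; first exact: controlled0.
have [zm|zm] := eqVneq z mC.
  by move: e0; rewrite (top_generalized_eigen_eq0 ve (p := p)) ?eqxx// -zm.
have zev : eigenvalue A z.
  apply: contraT; rewrite negbK /eigenspace kermx_eq0 row_free_unit => u.
  have {}u : horner_mx A (('X - z%:P) ^+ p) \in unitmx.
    rewrite rmorphXn rmorphB/= horner_mx_X horner_mx_C.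
    exact: unitrX.
  by move: e0; rewrite -(mulKmx u e) he mulmx0 eqxx.
have rez := hs z zev zm.
have hL : horner_mx A (\prod_(y <- nseq p z) ('X - y%:P)) *m e = 0.
  by rewrite big_nseq iter_mulr_1.
have [/eqP zeq|zne] := boolP (complex.Re z == m / 2).
  apply: (@controlled_roots _ (complex.Re z) d _ _ _ _ hL).
  - by rewrite size_nseq pd.
  - by move=> y /nseqP[-> _].
  - by right.
apply: (@controlled_roots _ (complex.Re z) p _ _ _ _ hL); first by rewrite size_nseq.
  by move=> y /nseqP[-> _].
by left; rewrite lt_neqAle zne.
Qed.

(** Expand u = U V u along the columns of U.  The k-th column of a block of size p
    is annihilated by the power k + 1 <= p of A - z, and projecting the expansion on
    the orthogonal of v1 leaves u unchanged. *)
Lemma controlled_critical (d : nat) u :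
  (forall lambda : R[i], eigenvalue A lambda -> lambda != mC ->
     complex.Re lambda <= m / 2) ->
  nu = d.*2.+1 -> largest_critical_block r m d.+1 ->
  v *m u = 0 -> controlled u.
Proof.
move=> hs nuE [b [p [a [[p_gt0 [U [V [UV VU AE]]]] pmax]]]] vu.
pose e i (k : 'I_(p i)) := col k (submxrow U i).
have AU i : A *m submxrow U i = submxrow U i *m jordan_block (p i) (a i).
  rewrite mul_submxrow /A AE -!mulmxA VU mulmx1 -{1}(submxrowK U).
  by rewrite mul_mxrow_mxdiag mxrowK.
have Ae i (k : 'I_(p i)) : horner_mx A ('X - (a i)%:P) *m e i k =
    \sum_(l < p i | l.+1 == k) e i l.
  rewrite rmorphB/= horner_mx_X horner_mx_C mulmxBl mul_scalar_mx.
  by rewrite /e colE mulmxA AU -!colE col_mul_jordan addrC addKr.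
have eE i (k : 'I_(p i)) : horner_mx A (('X - (a i)%:P) ^+ k.+1) *m e i k = 0.
  case: k => k kp; rewrite /=; elim: k kp => [|k IH] kp.
    by rewrite expr1 Ae big_pred0.
  rewrite exprSr rmorphM/= -mulmxA Ae (big_pred1 (Ordinal (ltnW kp))).
    exact: IH.
  by move=> l; rewrite /= eqSS -val_eqE.
pose c i k := (submxcol V i *m u) k 0.
have uE : u = \sum_(i < b) \sum_(k < p i) c i k *: (e i k - (v *m e i k) 0 0 *: ones).
  have uE : u = \sum_(i < b) \sum_(k < p i) c i k *: e i k.
    rewrite -[u in LHS]mul1mx -UV -{1}(submxrowK U) -(submxcolK V).
    rewrite mul_mxrow_mxcol mulmx_suml; apply: eq_bigr => i _.
    rewrite -mulmxA; apply/colP => x; rewrite mxE summxE.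
    by apply: eq_bigr => k _; rewrite [RHS]mxE [e _ _ _ _]mxE mulrC.
  have ve0 : \sum_(i < b) \sum_(k < p i) c i k * (v *m e i k) 0 0 = 0.
    have := congr1 (fun x => (v *m x) 0 0) uE; rewrite vu mxE.
    rewrite mulmx_sumr summxE => h; rewrite [RHS]h; apply: eq_bigr => i _.
    rewrite mulmx_sumr summxE; apply: eq_bigr => k _.
    by rewrite -scalemxAr [RHS]mxE.
  rewrite [LHS](_ : u = u - 0 *: ones); last by rewrite scale0r subr0.
  rewrite -ve0 {1}uE scaler_suml -sumrB; apply: eq_bigr => i _.
  rewrite scaler_suml -sumrB; apply: eq_bigr => k _.
  by rewrite scalerBr scalerA.
rewrite uE; apply: controlled_sum => i; apply: controlled_sum => k.
apply: controlledZ; apply: (@controlled_generalized d (p i) (a i)) => //.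
  move=> aE; rewrite -pmax; rewrite (bigD1 i)/= ?leq_maxl//; exact/eqP.
by rewrite -(subnK (ltn_ord k)) exprD rmorphM/= -mulmxA eE mulmx0.
Qed.

Lemma propag_square_sum (u : 'cV[R]_n.+1) :
  small_urn r m -> urn_exponent r m nu -> v1 *m u = 0 ->
  exists2 C : R, 0 <= C & forall t, (1 < t)%N ->
    \sum_(k < t.+1)
      cnorm (map_mx (real_complex R) (propag r S k (t - k) u)) ^+ 2
      <= C * nlog R nu t.
Proof.
move=> [_ hs] hnu vu.
suff [C C0 hC] : controlled (map_mx (real_complex R) u).
  exists C => // t t1; rewrite (le_trans _ (hC t t1))// ler_sum// => k _.
  by rewrite map_propag.
have vu' : v *m map_mx (real_complex R) u = 0 by rewrite -map_mxM vu map_mx0.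
case: hnu => [[[_ hs'] _]|[_ [d [hd nuE]]]].
  exact: controlled_strict.
exact: controlled_critical hd vu'.
Qed.

End bound.
End decomposition.

(** * Expectations of integrable real functions *)

Section mean.
Variables (d : measure_display) (T : measurableType d) (R : realType).
Variable P : probability T R.
Implicit Types f g : T -> R.

Definition mean f : R := fine ('E_P[f])%E.

Definition has_mean f : Prop := P.-integrable [set: T] (EFin \o f).

Lemma meanE f : has_mean f -> ('E_P[f] = (mean f)%:E)%E.
Proof.
move=> hf; rewrite /mean fineK// unlock; exact: integrable_fin_num.
Qed.

Lemma has_mean_cst (a : R) : has_mean (fun=> a).
Proof. exact: finite_measure_integrable_cst. Qed.

Lemma mean_cst (a : R) : mean (fun=> a) = a.
Proof. by rewrite /mean (expectation_cst P a). Qed.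

Lemma has_meanD f g : has_mean f -> has_mean g -> has_mean (fun t => f t + g t).
Proof. by move=> hf hg; exact: (integrableD measurableT hf hg). Qed.

Lemma meanD f g : has_mean f -> has_mean g ->
  mean (fun t => f t + g t) = mean f + mean g.
Proof. by move=> hf hg; rewrite /mean unlock -RintegralD. Qed.

Lemma has_meanZ (a : R) f : has_mean f -> has_mean (fun t => a * f t).
Proof. by move=> hf; exact: (integrableZl measurableT a hf). Qed.

Lemma meanZ (a : R) f : has_mean f -> mean (fun t => a * f t) = a * mean f.
Proof. by move=> hf; rewrite /mean unlock -RintegralZl. Qed.

Lemma has_mean_sum (I : Type) (q : seq I) (f : I -> T -> R) :
  (forall i, has_mean (f i)) -> has_mean (fun t => \sum_(i <- q) f i t).
Proof.
move=> hf; elim: q => [|i q IH].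
  rewrite (_ : (fun _ => _) = fun=> 0); first exact: has_mean_cst.
  by apply/funext => t; rewrite big_nil.
rewrite (_ : (fun _ => _) = fun t => f i t + \sum_(i <- q) f i t).
  exact: has_meanD.
by apply/funext => t; rewrite big_cons.
Qed.

Lemma mean_sum (I : Type) (q : seq I) (f : I -> T -> R) :
  (forall i, has_mean (f i)) ->
  mean (fun t => \sum_(i <- q) f i t) = \sum_(i <- q) mean (f i).
Proof.
move=> hf; elim: q => [|i q IH].
  rewrite big_nil -[RHS](mean_cst 0); congr mean.
  by apply/funext => t; rewrite big_nil.
rewrite big_cons -IH -meanD//; last exact: has_mean_sum.
by congr mean; apply/funext => t; rewrite big_cons.
Qed.

Lemma mean_le f g : has_mean f -> has_mean g -> (forall t, f t <= g t) ->
  mean f <= mean g.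
Proof. by move=> hf hg fg; rewrite /mean unlock; exact: le_Rintegral. Qed.

Lemma has_mean_le f g : measurable_fun [set: T] (f : T -> R) ->
  (forall t, `|f t| <= g t) -> has_mean g -> has_mean f.
Proof.
move=> mf fg; apply: le_integrable => //; first exact/measurable_EFinP.
by move=> t _ /=; rewrite lee_fin (le_trans (fg t))// ler_norm.
Qed.

Lemma has_mean_ge0 f (M : R) : measurable_fun [set: T] (f : T -> R) ->
  (forall t, 0 <= f t) -> ('E_P[f] <= M%:E)%E -> has_mean f /\ mean f <= M.
Proof.
move=> mf f0 fM; have hf : has_mean f.
  apply/integrableP; split; first exact/measurable_EFinP.
  under eq_integral do rewrite /= ger0_norm//.
  by move: fM; rewrite unlock => /le_lt_trans; apply; rewrite ltry.
by split=> //; rewrite -lee_fin -meanE.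
Qed.

Lemma has_mean_bounded f (M : R) : measurable_fun [set: T] (f : T -> R) ->
  (forall t, `|f t| <= M) -> has_mean f.
Proof. by move=> mf /(has_mean_le mf); apply; exact: has_mean_cst. Qed.

Lemma mean_close f g h (b : R) : has_mean f -> has_mean g -> has_mean h ->
  (forall t, `|f t - g t| <= h t) -> mean h <= b -> `|mean f - mean g| <= b.
Proof.
move=> hf hg hh fgh hb; rewrite ler_norml; apply/andP; split.
  rewrite lerBrDr addrC lerBlDr (le_trans _ (lerD (lexx _) hb))//.
  rewrite -meanD//; apply: mean_le => //; first exact: has_meanD.
  by move=> t; have := fgh t; rewrite ler_norml => /andP[]; lra.
rewrite lerBlDr addrC (le_trans _ (lerD (lexx _) hb))//.
rewrite -meanD//; apply: mean_le => //; first exact: has_meanD.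
by move=> t; have := fgh t; rewrite ler_norml => /andP[]; lra.
Qed.

Lemma norm_pow_le (x : R) (j k : nat) : (j <= k.*2)%N ->
  `|x ^+ j| <= 1 + x ^+ k.*2.
Proof.
move=> jk; rewrite normrX even_pow_norm; have [x1|x1] := leP `|x| 1.
  by rewrite (@le_trans _ _ 1)// ?exprn_ile1// lerDl exprn_ge0.
by rewrite (le_trans (ler_weXn2l (ltW x1) jk))// lerDr.
Qed.

Lemma has_mean_pow f (j k : nat) : measurable_fun [set: T] (f : T -> R) ->
  has_mean (fun t => f t ^+ k.*2) -> (j <= k.*2)%N ->
  has_mean (fun t => f t ^+ j).
Proof.
move=> mf hf jk; apply: (@has_mean_le _ (fun t => 1 + f t ^+ k.*2)).
- exact: measurable_funX.
- by move=> t; exact: norm_pow_le.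
- by apply: has_meanD => //; exact: has_mean_cst.
Qed.

End mean.

(** * The urn as a finite Markov chain *)

Section finitely_valued.
Variables (d : measure_display) (T : measurableType d) (R : realType).
Variables (P : probability T R) (E : eqType) (tau : T -> E) (q : seq E).
Hypotheses (q_uniq : uniq q) (tau_q : forall t, tau t \in q).
Hypothesis tau_meas : forall e, measurable [set t | tau t = e].

Let fiber e := [set t | tau t = e].

Let decomp (f : E -> R) t :
  f (tau t) = \sum_(e <- q) f e * \1_(fiber e) t.
Proof.
rewrite (bigD1_seq (tau t))//= indicE mem_set// mulr1 big1 ?addr0// => e et.
rewrite indicE memNset ?mulr0//= => h; by rewrite /fiber/= h eqxx in et.
Qed.

Lemma finite_measurable (f : E -> R) :
  measurable_fun [set: T] (fun t => f (tau t)).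
Proof.
rewrite (_ : (fun t => f (tau t)) =
  fun t => \sum_(e <- q) f e * \1_(fiber e) t); last first.
  by apply/funext => t; exact: decomp.
apply: measurable_sum => e; apply: measurable_funM => //.
by apply: measurable_indic; exact: tau_meas.
Qed.

Lemma finite_expectation (f : E -> R) :
  ('E_P[fun t => f (tau t)] =
     (\sum_(e <- q) fine (P (fiber e)) * f e)%R%:E)%E.
Proof.
rewrite unlock.
under eq_integral => t _ do
  (rewrite decomp -sumEFin; under eq_bigr do rewrite EFinM).
rewrite integral_sum//; last first.
  by move=> e; apply: integrableZl => //; exact: (integrable_indic P (tau_meas e)).
rewrite -sumEFin; apply: eq_bigr => e _.
rewrite integralZl//; last exact: (integrable_indic P (tau_meas e)).
rewrite integral_indic//; last exact: tau_meas.
by rewrite setIT muleC EFinM fineK// fin_num_measure//; exact: tau_meas.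
Qed.

End finitely_valued.

Lemma nonneg_nonzero_sum_gt0 (R : realType) (s : nat) (x : 'rV[R]_s) :
  nonneg_nonzero x -> 0 < \sum_j x 0 j.
Proof.
move=> [x_ge x_neq]; rewrite lt_neqAle sumr_ge0// andbT eq_sym psumr_neq0//.
have /existsP[i xi] : [exists i, x 0 i != 0].
  apply: contraR x_neq; rewrite negb_exists => /forallP h.
  by apply/eqP/rowP => i; rewrite mxE; apply/eqP; have := h i; rewrite negbK.
by apply/hasP; exists i; rewrite ?mem_index_enum//= lt_neqAle eq_sym xi x_ge.
Qed.

Section urn.
Variables (R : realType) (s : nat) (r : 'M[R]_s) (m : R) (x0 : 'rV[R]_s).
Variables (d : measure_display) (T : measurableType d) (P : probability T R).
Variables (X : nat -> T -> 'rV[R]_s) (K : nat -> T -> 'I_s).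
Hypotheses (hX : polya_urn P r x0 X K) (hten : tenable P X).
Hypothesis hbal : balanced r m.

(** The transition operator of the urn: the expectation of [phi] after one draw from
    the composition [x]. *)
Definition draw_mean (phi : 'rV[R]_s -> R) (x : 'rV[R]_s) : R :=
  \sum_(k < s) (x 0 k / \sum_(j < s) x 0 j) * phi (x + row k r).

Let traj n t := [seq X i t | i <- iota 0 n.+1].

(** All possible values of the past of the urn; the past takes its values in a finite
    list, which makes conditioning elementary. *)
Fixpoint trajs n : seq (seq 'rV[R]_s) :=
  if n is n'.+1 then
    undup [seq rcons e (last 0 e + row k r) | e <- trajs n', k <- enum 'I_s]
  else [:: [:: x0]].

Let trajS n t : traj n.+1 t = rcons (traj n t) (X n.+1 t).
Proof. by rewrite /traj -(addn1 n.+1) iotaD map_cat cats1. Qed.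

Let last_traj n t : last 0 (traj n t) = X n t.
Proof. by case: n => [//|n]; rewrite trajS last_rcons. Qed.

Let size_traj n t : size (traj n t) = n.+1.
Proof. by rewrite size_map size_iota. Qed.

Let traj_in n t : traj n t \in trajs n.
Proof.
elim: n => [|n IH]; first by rewrite /traj/= (urn_start hX) inE.
rewrite trajS (urn_step hX) [trajs _]/= mem_undup; apply/allpairsP.
by exists (traj n t, K n t); rewrite mem_enum IH last_traj.
Qed.

Let trajs_uniq n : uniq (trajs n).
Proof. by case: n => //= n; rewrite undup_uniq. Qed.

Let meas_X n x : measurable [set t | X n t = x].
Proof.
elim: n x => [|n IH] x.
  have [<-|xx0] := eqVneq x0 x.
    rewrite (_ : mkset _ = [set: T]); first exact: measurableT.
    by apply/seteqP; split=> t //= _; rewrite (urn_start hX).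
  rewrite (_ : mkset _ = set0); first exact: measurable0.
  by apply/seteqP; split=> t //=; rewrite (urn_start hX) => h; rewrite h eqxx in xx0.
rewrite (_ : mkset _ = \bigcup_k
   ([set t | K n t = k] `&` [set t | X n t = x - row k r])).
  apply: countable_bigcupT_measurable; first exact: countableP.
  by move=> k; apply: measurableI => //; exact: (urn_draw_measurable hX).
apply/seteqP; split=> t /=; rewrite (urn_step hX).
  by move=> h; exists (K n t) => //; split=> //=; rewrite -h addrK.
by move=> [k _ [/= -> ->]]; rewrite subrK.
Qed.

Let past n (x : nat -> 'rV[R]_s) := [set t | forall i, (i <= n)%N -> X i t = x i].

Let traj_past n e : size e = n.+1 ->
  [set t | traj n t = e] = past n (nth 0 e).
Proof.
move=> se; apply/seteqP; split=> t /=.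
  move=> <- i i_n; rewrite (nth_map 0%N) ?size_iota ?ltnS//.
  by rewrite nth_iota ?ltnS// add0n.
move=> h; apply: (@eq_from_nth _ 0); rewrite ?size_traj//.
move=> i i_n; rewrite (nth_map 0%N) ?size_iota// nth_iota// add0n h//.
Qed.

Let meas_past n x : measurable (past n x).
Proof.
rewrite (_ : past n x = \bigcap_(i in `I_n.+1) [set t | X i t = x i]).
  by apply: bigcap_measurable => //; exists 0%N.
by apply/seteqP; split=> t /= h i; have := h i; rewrite /= ltnS.
Qed.

Let meas_traj n e : measurable [set t | traj n t = e].
Proof.
have [/eqP se|se] := boolP (size e == n.+1); first by rewrite traj_past.
rewrite (_ : mkset _ = set0); first exact: measurable0.
by apply/seteqP; split=> t //= h; rewrite -h size_traj eqxx in se.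
Qed.

Let meas_trajK n (ek : seq 'rV[R]_s * 'I_s) :
  measurable [set t | (traj n t, K n t) = ek].
Proof.
rewrite (_ : mkset _ = [set t | traj n t = ek.1] `&` [set t | K n t = ek.2]).
  by apply: measurableI => //; exact: (urn_draw_measurable hX).
by case: ek => e k; apply/seteqP; split=> t /= [-> ->].
Qed.

(** Sum over the pasts and the colour drawn, using the conditional draw probabilities.
    Only the last composition of a past enters the result. *)
Lemma urn_markov n (phi : 'rV[R]_s -> R) :
  ('E_P[phi \o X n.+1] = 'E_P[draw_mean phi \o X n])%E.
Proof.
pose g (e : seq 'rV[R]_s) := draw_mean phi (last 0 e).
rewrite (_ : draw_mean phi \o X n = fun t => g (traj n t)); last first.
  by apply/funext => t; rewrite /g /comp last_traj.
rewrite (finite_expectation P (trajs_uniq n) (traj_in n))//.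
pose g' (ek : seq 'rV[R]_s * 'I_s) := phi (last 0 ek.1 + row ek.2 r).
rewrite (_ : phi \o X n.+1 = fun t => g' (traj n t, K n t)); last first.
  by apply/funext => t; rewrite /g' /comp (urn_step hX) -[X n t]last_traj.
rewrite (@finite_expectation _ _ _ P _ (fun t => (traj n t, K n t))
  (allpairs pair (trajs n) (enum 'I_s))) //; last first.
- by move=> t; apply/allpairsP; exists (traj n t, K n t); rewrite mem_enum traj_in.
- by apply: allpairs_uniq => //; [exact: enum_uniq|move=> [? ?] [? ?]].
congr (_%:E); rewrite big_allpairs_dep/=; apply: eq_big_seq => e eq.
rewrite big_enum/= /g /draw_mean mulr_sumr; apply: eq_bigr => k _.
rewrite mulrA; congr (_ * _).
have se : size e = n.+1.
  elim: n e eq {g g'} => [|n IH] e; first by rewrite inE => /eqP ->.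
  rewrite /= mem_undup => /allpairsP[[e' k'] [/= /IH se' _ ->]].
  by rewrite size_rcons se'.
rewrite (_ : mkset _ = past n (nth 0 e) `&` [set t | K n t = k]); last first.
  rewrite -traj_past//.
  by apply/seteqP; split=> t /= [-> ->].
rewrite (urn_draw hX) -/(past n _) traj_past// fineM//; last first.
  by rewrite fin_num_measure.
by rewrite /= (_ : last 0 e = nth 0 e n)// (last_nth 0) se.
Qed.

(** Every expectation below is a finite sum over compositions.  Those of positive
    probability are nonnegative by tenability, with a deterministic total since the
    urn is balanced. *)
Lemma urn_law n : exists (q : seq 'rV[R]_s) (p : 'rV[R]_s -> R),
  [/\ forall x, 0 <= p x,
      forall x, p x != 0 ->
        nonneg_nonzero x /\ \sum_j x 0 j = \sum_j x0 0 j + n%:R * m,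
      forall phi, 'E_P[phi \o X n]%E = (\sum_(x <- q) p x * phi x)%:E &
      forall phi, measurable_fun [set: T] (fun t => phi (X n t) : R)].
Proof.
pose q := undup (map (last 0) (trajs n)).
have Xq t : X n t \in q.
  by rewrite mem_undup -last_traj map_f.
exists q, (fun x => fine (P [set t | X n t = x])); split.
- by move=> x; rewrite fine_ge0.
- move=> x px; split.
    apply: contra_notP (negP px) => xn; apply/eqP.
    rewrite (_ : P _ = 0%E)//; apply: measure_negligible => //.
    apply: negligibleS hten => t /= Xx h; apply: xn; rewrite -Xx.
    exact: h.
  have [t Xt] : exists t, X n t = x.
    apply: contra_notP (negP px) => xn; apply/eqP.
    rewrite (_ : mkset _ = set0) ?measure0//.
    by apply/seteqP; split=> t //= Xt; apply: xn; exists t.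
  rewrite -Xt; elim: n {px Xq q Xt} => [|k IH].
    by rewrite (urn_start hX) mul0r addr0.
  rewrite (urn_step hX); under eq_bigr do rewrite !mxE.
  by rewrite big_split/= IH hbal -natr1 mulrDl mul1r addrA.
- move=> phi; exact: (finite_expectation P (undup_uniq _) Xq (meas_X n)).
- move=> phi; exact: (finite_measurable (undup_uniq _) Xq (meas_X n)).
Qed.

Lemma urn_mean0 phi : ('E_P[phi \o X 0%N] = (phi x0)%:E)%E.
Proof.
rewrite (_ : phi \o _ = cst (phi x0)) ?expectation_cst//.
by apply/funext => t /=; rewrite (urn_start hX).
Qed.

End urn.

(** * Exponential and even moments of the urn *)

(** Hoeffding's lemma with a crude constant: a centred variable bounded by b has
    exp (d) = 1 + d + O(b^2), and d disappears in the mean. *)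
Lemma centred_mgf_le (R : realType) (s : nat) (p z : 'I_s -> R) (b : R) :
  (forall i, 0 <= p i) -> \sum_i p i = 1 -> (forall i, `|z i| <= b / 2) ->
  b <= 1 / 2 ->
  \sum_i p i * expR (z i - \sum_j p j * z j) <= expR (2 * b ^+ 2).
Proof.
move=> p0 p1 zb b1; set mu := \sum_j p j * z j.
have mu_b : `|mu| <= b / 2.
  rewrite (le_trans (ler_norm_sum _ _ _))//.
  rewrite -[leRHS]mul1r -[X in _ <= X * _]p1 mulr_suml ler_sum// => i _.
  by rewrite normrM ger0_norm// ler_wpM2l.
have zmu i : `|z i - mu| <= b.
  by rewrite (le_trans (ler_normB _ _))//; move: (zb i) mu_b; lra.
apply: (@le_trans _ _ (\sum_i p i * (1 + (z i - mu) + 2 * b ^+ 2))).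
  apply: ler_sum => i _; rewrite ler_wpM2l//.
  apply: le_trans (expR_le1Dxx (le_trans (zmu i) b1)) _.
  rewrite lerD2l ler_wpM2l// -(real_normK (num_real (z i - mu))).
  apply: lerXn2r; rewrite ?nnegrE//.
  exact: le_trans (normr_ge0 _) (zmu i).
apply: le_trans (expR_ge1Dx _).
rewrite le_eqVlt; apply/orP; left; apply/eqP.
rewrite (eq_bigr (fun i => p i * z i + p i * (1 - mu + 2 * b ^+ 2))).
  by rewrite big_split/= -mulr_suml p1 -/mu; ring.
by move=> i _; ring.
Qed.

Section moments.
Variables (R : realType) (s : nat) (r : 'M[R]_s) (m : R) (x0 : 'rV[R]_s).
Variables (d : measure_display) (T : measurableType d) (P : probability T R).
Variables (X : nat -> T -> 'rV[R]_s) (K : nat -> T -> 'I_s).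
Hypotheses (hX : polya_urn P r x0 X K) (hten : tenable P X).
Hypothesis hbal : balanced r m.
Let S n : R := \sum_j x0 0 j + n%:R * m.

Lemma urn_mean_le n (phi psi : 'rV[R]_s -> R) :
  (forall x, nonneg_nonzero x -> \sum_j x 0 j = S n -> phi x <= psi x) ->
  ('E_P[phi \o X n] <= 'E_P[psi \o X n])%E.
Proof.
move=> h; have [q [p [p0 hp E _]]] := urn_law hX hten hbal n.
rewrite !E lee_fin ler_sum// => x _.
have [->|px] := eqVneq (p x) 0; first by rewrite !mul0r.
by have [xn xS] := hp x px; rewrite ler_wpM2l// h.
Qed.

Let rho : R := \sum_k \sum_j `|r k j|.

Lemma row_mul_bound k (c : 'cV[R]_s) :
  `|(row k r *m c) 0 0| <= rho * cnorm (map_mx (real_complex R) c).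
Proof.
rewrite mxE (le_trans (ler_norm_sum _ _ _))//.
apply: (@le_trans _ _ (\sum_j `|r k j| * cnorm (map_mx (real_complex R) c))).
  apply: ler_sum => j _; rewrite mxE normrM ler_wpM2l//.
  exact: cnorm_ge_entry.
rewrite -mulr_suml ler_wpM2r ?cnorm_ge0// /rho [leRHS](bigD1 k)//= lerDl.
by apply: sumr_ge0 => i _; apply: sumr_ge0.
Qed.

(** Induction on the time k, from 0 to t, for the exponential of theta X_k c_k.  One
    draw multiplies it by the exponential of theta times a centred variable, since
    x c_k is the mean of (x + r_i) c_{k+1} when i is drawn with probability x_i / S_k. *)
Lemma urn_mgf (t : nat) (u : 'cV[R]_s) (theta V : R) :
  let cn k := cnorm (map_mx (real_complex R) (propag r S k (t - k) u)) in
  \sum_(k < t.+1) cn k ^+ 2 <= V ->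
  (4 * rho * theta) ^+ 2 * V <= 1 ->
  ('E_P[(fun x : 'rV[R]_s => (expR (theta * (x *m u) 0 0))%R) \o X t] <=
    (expR (theta * (x0 *m propag r S 0 t u) 0 0 + 1 / 2))%R%:E)%E.
Proof.
move=> cn hV hth; pose c k := propag r S k (t - k) u.
have cn0 k : 0 <= cn k by exact: cnorm_ge0.
pose b k := 2 * rho * `|theta| * cn k.
have rho0 : 0 <= rho by apply: sumr_ge0 => i _; apply: sumr_ge0.
have b0 k : 0 <= b k by rewrite !mulr_ge0.
have bE k : b k ^+ 2 = (4 * rho * theta) ^+ 2 * cn k ^+ 2 / 4.
  rewrite /b !exprMn (real_normK (num_real theta)).
  by move: (theta ^+ 2) => th2; field.
have b1 k : (k <= t)%N -> b k <= 1 / 2.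
  move=> kt; rewrite -(@ler_pXn2r _ 2) ?nnegrE// ?divr_ge0// bE.
  suff : (4 * rho * theta) ^+ 2 * cn k ^+ 2 <= 1 by lra.
  rewrite (le_trans _ hth)// ler_wpM2l ?sqr_ge0// (le_trans _ hV)//.
  rewrite -ltnS in kt; rewrite (bigD1 (Ordinal kt))//= lerDl.
  by apply: sumr_ge0 => i _; rewrite sqr_ge0.
have main k : (k <= t)%N ->
    ('E_P[(fun x : 'rV[R]_s => expR (theta * (x *m c k) 0 0)%R) \o X k] <=
     (expR (theta * (x0 *m c 0%N) 0 0 +
        \sum_(1 <= j < k.+1) 2 * b j ^+ 2)%R)%:E)%E.
  elim: k => [|k IH] kt.
    by rewrite (urn_mean0 hX) big_geq// addr0.
  pose psi (x : 'rV[R]_s) := expR (2 * b k.+1 ^+ 2) * expR (theta * (x *m c k) 0 0).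
  rewrite (urn_markov hX); apply: (@le_trans _ _ ('E_P[psi \o X k])%E); last first.
    have [q [p [p0 hp E _]]] := urn_law hX hten hbal k.
    have := IH (ltnW kt); rewrite !E !lee_fin => h.
    rewrite big_nat_recr//= addrA expRD [leRHS]mulrC.
    apply: le_trans (ler_wpM2l (expR_ge0 _) h); rewrite mulr_sumr.
    by apply: ler_sum => x _; rewrite mulrCA.
  apply: urn_mean_le => x xn xS; rewrite /draw_mean xS.
  have Sk : 0 < S k by rewrite -xS; exact: nonneg_nonzero_sum_gt0.
  have x_ge := xn.1.
  have ck : c k = c k.+1 + (S k)^-1 *: (r *m c k.+1).
    by rewrite /c (_ : (t - k)%N = (t - k.+1).+1)// -subSn// subSS.
  pose z i := theta * (row i r *m c k.+1) 0 0.
  pose p i := x 0 i / S k.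
  have pz : \sum_j p j * z j = theta * (S k)^-1 * (x *m (r *m c k.+1)) 0 0.
    rewrite mxE mulr_sumr; apply: eq_bigr => j _.
    by rewrite /p /z -row_mul mxE; ring.
  have zb i : `|z i| <= b k.+1 / 2.
    rewrite /z normrM /b.
    have := ler_wpM2l (normr_ge0 theta) (row_mul_bound i (c k.+1)).
    by rewrite -/(cn k.+1); lra.
  have psum : \sum_i p i = 1 by rewrite -mulr_suml xS divff// gt_eqF.
  have pge i : 0 <= p i by rewrite divr_ge0// ltW.
  have := centred_mgf_le pge psum zb (b1 _ kt).
  move/(ler_wpM2r (expR_ge0 (theta * (x *m c k) 0 0)))/(le_trans _); apply.
  rewrite le_eqVlt; apply/orP; left; apply/eqP.
  have eqi i : x 0 i / S k * expR (theta * ((x + row i r) *m c k.+1) 0 0) =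
      p i * expR (z i - \sum_j p j * z j) * expR (theta * (x *m c k) 0 0).
    rewrite -[RHS]mulrA -expRD pz; congr (_ * expR _).
    by rewrite ck mulmxDr mulmxDl -scalemxAr /z !mxE; ring.
  by rewrite (eq_bigr _ (fun i _ => eqi i)) mulr_suml.
have := main t (leqnn _); rewrite /c subnn subn0 => /le_trans; apply.
rewrite lee_fin ler_expR lerD2l.
apply: (@le_trans _ _ (\sum_(k < t.+1) 2 * b k ^+ 2)).
  rewrite -(big_mkord xpredT (fun k => 2 * b k ^+ 2)) [leRHS]big_ltn// lerDr.
  by rewrite mulr_ge0 ?sqr_ge0.
under eq_bigr do rewrite bE.
rewrite (eq_bigr (fun k : 'I_t.+1 => (4 * rho * theta) ^+ 2 / 2 * cn k ^+ 2)).
  rewrite -mulr_sumr.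
  have := ler_wpM2l (sqr_ge0 (4 * rho * theta)) hV; lra.
by move=> k _; field.
Qed.

(** Even powers are bounded by hyperbolic cosines.  With theta of order
    1 / sqrt (C L), the quadratic term in the exponent is bounded; the deterministic
    starting value X_0 c_0 is bounded through the term k = 0 of the sum. *)
Lemma urn_even_moments (u : 'cV[R]_s) (C : R) (L : nat -> R) :
  0 <= C ->
  (forall t, (1 < t)%N ->
    \sum_(k < t.+1)
      cnorm (map_mx (real_complex R) (propag r S k (t - k) u)) ^+ 2
      <= C * L t) ->
  (forall t, (1 < t)%N -> 0 < L t) ->
  forall q, exists M : R, forall t, (1 < t)%N ->
   ('E_P[(fun x : 'rV[R]_s =>
      ((x *m u) 0 0 / Num.sqrt (L t)) ^+ q.*2)%R \o X t] <= M%:E)%E.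
Proof.
move=> C0 hC L0 q.
(* the added units keep [a] positive when r = 0 or C = 0 *)
pose a : R := (4 * (rho + 1) * (Num.sqrt C + 1))^-1.
have rho0 : 0 <= rho by apply: sumr_ge0 => i _; apply: sumr_ge0.
have a0 : 0 < a.
  by rewrite invr_gt0 !mulr_gt0// ltr_wpDl// sqrtr_ge0.
pose B := (\sum_j `|x0 0 j|) * Num.sqrt C.
have B0 : 0 <= B by rewrite mulr_ge0 ?sumr_ge0 ?sqrtr_ge0.
pose M := 2 ^+ q.*2 * (a^-1 ^+ q.*2 * ((q.*2)`!%:R * (expR (1 / 2) + expR (1/2)))
   + B ^+ q.*2).
exists M => t t1.
have Lt := L0 t t1; set sL := Num.sqrt (L t).
have sL0 : 0 < sL by rewrite sqrtr_gt0.
pose c0 := (x0 *m propag r S 0 t u) 0 0.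
pose theta := a / sL.
have th0 : 0 < theta by rewrite divr_gt0.
have sqL : sL ^+ 2 = L t by rewrite sqr_sqrtr// ltW.
have hth : (4 * rho * theta) ^+ 2 * (C * L t) <= 1.
  rewrite -sqL -[C]sqr_sqrtr// -!exprMn.
  have nn : 0 <= 4 * rho * theta * (Num.sqrt C * sL).
    apply: mulr_ge0; first by apply: mulr_ge0; [exact: mulr_ge0|exact: ltW].
    by apply: mulr_ge0; [exact: sqrtr_ge0|exact: ltW].
  rewrite -[leRHS](expr1n _ 2); apply: lerXn2r; rewrite ?nnegrE//.
  have -> : 4 * rho * theta * (Num.sqrt C * sL) = (4 * rho * Num.sqrt C) * a.
    by rewrite /theta; field; rewrite gt_eqF.
  rewrite /a ler_pdivrMr; last by rewrite -invr_gt0.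
  have := sqrtr_ge0 C; rewrite mul1r; nra.
have hthN : (4 * rho * - theta) ^+ 2 * (C * L t) <= 1.
  by rewrite mulrN sqrrN.
have e1 := urn_mgf (hC t t1) hth.
have e2 := urn_mgf (hC t t1) hthN.
have [qq [p [p0 hp E _]]] := urn_law hX hten hbal t.
rewrite !E in e1 e2 *; rewrite !lee_fin in e1 e2 *.
rewrite -/c0 in e1 e2.
have c0B : (c0 / sL) ^+ q.*2 <= B ^+ q.*2.
  rewrite even_pow_norm; apply: lerXn2r; rewrite ?nnegrE//.
  rewrite normrM [`|sL^-1|]ger0_norm ?invr_ge0 ?(ltW sL0)// ler_pdivrMr//.
  rewrite /c0 mxE (le_trans (ler_norm_sum _ _ _))// /B -mulrA mulr_suml.
  apply: ler_sum => j _; rewrite normrM ler_wpM2l//.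
  apply: le_trans (cnorm_ge_entry _ _) _.
  rewrite -sqrtrM// -[leLHS]ger0_norm ?cnorm_ge0// -sqrtr_sqr ler_wsqrtr//.
  rewrite (le_trans _ (hC t t1))// (bigD1 ord0)//= subn0 lerDl.
  by apply: sumr_ge0 => i _; rewrite sqr_ge0.
have p1 : \sum_(x <- qq) p x = 1.
  have := E (cst 1); rewrite (_ : cst 1 \o _ = cst 1)// expectation_cst => -[].
  by move=> ->; apply: eq_bigr => x _; rewrite mulr1.
pose D (x : 'rV[R]_s) := (x *m u) 0 0 - c0.
have pt x : ((x *m u) 0 0 / sL) ^+ q.*2 <=
   2 ^+ q.*2 * (a^-1 ^+ q.*2 * ((q.*2)`!%:R *
     (expR (theta * D x) + expR (- (theta * D x)))) + B ^+ q.*2).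
  have -> : (x *m u) 0 0 / sL = D x / sL + c0 / sL by rewrite /D; ring.
  apply: le_trans (even_powerD_le _ _ _) _.
  rewrite ler_wpM2l ?exprn_ge0// lerD//.
  have -> : D x / sL = a^-1 * (theta * D x).
    by rewrite /theta; field; rewrite !gt_eqF.
  rewrite exprMn ler_wpM2l ?even_power_le_expR// exprn_ge0// invr_ge0 ltW//.
apply: le_trans (ler_sum _ (fun x _ => ler_wpM2l (p0 x) (pt x))) _.
rewrite (_ : \sum_(i <- qq) _ = 2 ^+ q.*2 * (a^-1 ^+ q.*2 * ((q.*2)`!%:R *
  (expR (- (theta * c0)) * (\sum_(x <- qq) p x * expR (theta * (x *m u) 0 0)) +
  expR (theta * c0) * (\sum_(x <- qq) p x * expR (- theta * (x *m u) 0 0)))) +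
  B ^+ q.*2 * (\sum_(x <- qq) p x))); last first.
  rewrite !mulr_sumr -big_split/= !mulr_sumr -big_split/= mulr_sumr.
  apply: eq_bigr => x _; rewrite /D mulrBr opprB !expRD mulNr; ring.
clearbody a; rewrite p1 mulr1 /M ler_wpM2l ?exprn_ge0// lerD2r.
rewrite ler_wpM2l ?exprn_ge0 ?invr_ge0 ?(ltW a0)//.
rewrite ler_wpM2l// lerD//.
  apply: le_trans (ler_wpM2l (expR_ge0 _) e1) _.
  by rewrite -expRD addKr.
apply: le_trans (ler_wpM2l (expR_ge0 _) e2) _.
by rewrite mulNr -expRD addNKr.
Qed.

End moments.

(** * The normal law *)

Section normal.
Variable R : realType.
Local Notation mu := (@lebesgue_measure R).

(** By uniqueness of the Radon-Nikodym derivative. *)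
Lemma ge0_integral_normal_prob (a s : R) (f : R -> \bar R) :
  measurable_fun [set: R] f -> (forall x, 0 <= f x)%E ->
  (\int[normal_prob a s]_x f x = \int[mu]_x (f x * (normal_pdf a s x)%:E))%E.
Proof.
move=> mf f0.
rewrite -(Radon_Nikodym_SigmaFinite.change_of_variables
  (normal_prob_dominates a s))//=.
have dom := normal_prob_dominates a s.
apply: ae_eq_integral => //.
- apply: emeasurable_funM => //.
  exact: measurable_int (Radon_Nikodym_SigmaFinite.f_integrable dom).
- apply: emeasurable_funM => //; apply/measurable_EFinP.
  exact: measurable_normal_pdf.
- apply: ae_eqe_mul2l => /=; apply: integral_ae_eq => //=.
  + exact: Radon_Nikodym_SigmaFinite.f_integrable.
  + by apply/measurable_EFinP; exact: measurable_normal_pdf.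
  + by move=> E _ mE; rewrite -Radon_Nikodym_SigmaFinite.f_integral.
Qed.

(** Completing the square turns the integrand into a multiple of the density of the
    normal law translated by th s^2. *)
Lemma normal_mgf (s th : R) : s != 0 ->
  (\int[normal_prob 0 s]_x (expR (th * x))%:E =
   (expR (th ^+ 2 * s ^+ 2 / 2))%:E)%E.
Proof.
move=> s0; rewrite ge0_integral_normal_prob; last first.
- by move=> x; rewrite lee_fin expR_ge0.
- by apply/measurable_EFinP; apply: measurableT_comp => //; exact: measurable_funM.
under eq_integral => x _.
  rewrite (_ : (_ * _)%E = ((expR (th ^+ 2 * s ^+ 2 / 2))%:E *
     (normal_pdf (th * s ^+ 2) s x)%:E)%E); last first.
    rewrite -!EFinM !normal_pdfE// /normal_fun; congr EFin; rewrite /=.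
    rewrite mulrCA [RHS]mulrCA -!expRD; congr (_ * expR _).
    by field.
  over.
rewrite integralZl//; last exact: integrable_normal_pdf.
by rewrite integral_normal_pdf mule1.
Qed.

(** The substitution y = x / s maps the density of N(0, s^2) to that of N(0, 1). *)
Lemma normal_scale (s : R) (f : R -> R) : 0 < s ->
  continuous f -> (forall x, 0 <= f x) ->
  (\int[normal_prob 0 s]_x (f (x / s))%:E = \int[normal_prob 0 1]_x (f x)%:E)%E.
Proof.
move=> s0 cf f0; have s_neq0 : s != 0 by rewrite gt_eqF.
pose F (x : R^o) : R^o := x / s.
have cF : continuous F by move=> x; apply: cvgMl; exact: cvg_id.
have mf : measurable_fun [set: R] f by exact: continuous_measurable_fun.
have F'E : F^`()%classic = cst s^-1.
  apply/funext => x; rewrite /F derive1E deriveM// derive_cst scaler0 add0r.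
  by rewrite derive_id scaler1.
pose G x := f x * normal_pdf 0 1 x.
rewrite [RHS]ge0_integral_normal_prob; last first.
- by move=> x; rewrite lee_fin.
- exact/measurable_EFinP.
rewrite ge0_integral_normal_prob; last first.
- by move=> x; rewrite lee_fin.
- apply/measurable_EFinP; apply: measurableT_comp => //.
  exact: continuous_measurable_fun.
under [RHS]eq_integral do rewrite -EFinM.
rewrite (@increasing_ge0_integration_by_substitutionT _ F G); last first.
- by move=> x; rewrite mulr_ge0// normal_pdf_ge0.
- move=> x; apply: continuousM; first exact: cf.
  by apply: continuous_normal_pdf; rewrite oner_eq0.
- apply/gt0_cvgMly; last exact: cvg_id.
  by rewrite invr_gt0.
- apply/gt0_cvgMlNy; last exact: cvg_id.
  by rewrite invr_gt0.
- by move=> x; apply: derivableM.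
- by rewrite F'E; exact: is_cvg_cst.
- by rewrite F'E; exact: is_cvg_cst.
- by rewrite F'E => ?; exact: cvg_cst.
- by move=> x y xy; rewrite /F ltr_pM2r// invr_gt0.
apply: eq_integral => x _; rewrite F'E -EFinM; congr EFin.
rewrite /G /F !fctE/= -mulrA; congr (_ * _).
rewrite !normal_pdfE ?oner_eq0// /normal_fun /normal_peak/=.
rewrite [RHS]mulrAC; congr (_ * expR _); last by field.
rewrite -mulrnAr sqrtrM ?sqr_ge0// invfM sqrtr_sqr gtr0_norm// mulrC.
by rewrite expr1n mul1r.
Qed.

End normal.

Section law.
Variables (d : measure_display) (T : measurableType d) (R : realType).
Variable P : probability T R.
Variables (U : T -> R) (v : R).
Hypothesis mU : measurable_fun [set: T] (U : T -> R).
Hypothesis v_ge0 : 0 <= v.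
Hypothesis lawU : forall B : set R, measurable B ->
  P [set t | B (U t)] = centred_normal_law v B.

Lemma ge0_integral_law (f : R -> R) : measurable_fun [set: R] f ->
  (forall x, 0 <= f x) ->
  (\int[P]_t (f (U t))%:E = if (v == 0)%R then (f 0%R)%:E
     else \int[normal_prob 0 (Num.sqrt v)]_x (f x)%:E)%E.
Proof.
move=> mf f0.
case: ifPn => v0.
  have := @ge0_integral_pushforward _ _ _ _ _ U mU P setT (EFin \o f) measurableT.
  rewrite preimage_setT => <-; last 2 first.
  - exact/measurable_EFinP.
  - by move=> x _; rewrite lee_fin.
  rewrite (@eq_measure_integral _ _ _ _ (dirac (0 : R))).
    rewrite integral_dirac//; last exact/measurable_EFinP.
    by rewrite diracT mul1e.
  by move=> A mA _; rewrite [LHS](lawU mA) /centred_normal_law v0.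
(* [normal_prob] lives on the sigma-algebra generated by the half-open
   intervals, a structure distinct from the one inferred for [R]; the image law
   must be taken on the same one. *)
have := @ge0_integral_pushforward _ _ _ (measurableTypeR R) _ U mU P setT
  (EFin \o f) measurableT.
rewrite preimage_setT => <-; last 2 first.
- exact/measurable_EFinP.
- by move=> x _; rewrite lee_fin.
rewrite (@eq_measure_integral _ _ _ _ (normal_prob 0 (Num.sqrt v)))//.
by move=> A mA _; rewrite [LHS](lawU mA) /centred_normal_law (negbTE v0).
Qed.

(** The formula also covers the point mass, v = 0, and so makes the case distinction
    in the definition of the law harmless. *)
Lemma law_mgf (th : R) :
  ('E_P[fun t => expR (th * U t)] = (expR (th ^+ 2 * v / 2))%:E)%E.
Proof.
rewrite unlock (ge0_integral_law (f := fun x => expR (th * x))).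
- case: ifPn => [/eqP->|v0]; first by rewrite !mulr0 mul0r.
  rewrite normal_mgf; first by rewrite sqr_sqrtr.
  by rewrite gt_eqF// sqrtr_gt0 lt_neqAle eq_sym v0.
- by apply: measurableT_comp => //; exact: measurable_funM.
- by move=> x; rewrite expR_ge0.
Qed.

End law.

(** * Moments from the moment generating function *)

Section cosh.
Variable R : realType.
Implicit Types x z : R.

Let cosh_sqr x : expR x + expR (- x) - 2 = (expR (x / 2) - expR (- (x / 2))) ^+ 2.
Proof.
have e1 : expR x = expR (x / 2) ^+ 2.
  by rewrite expr2 -expRD; congr expR; field.
have e2 : expR (- x) = expR (- (x / 2)) ^+ 2.
  by rewrite expr2 -expRD; congr expR; field.
have e3 : expR (x / 2) * expR (- (x / 2)) = 1 by rewrite -expRD subrr expR0.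
by rewrite e1 e2 sqrrB e3; ring.
Qed.

Let sinh_ge z : 0 <= z -> 2 * z <= expR z - expR (- z).
Proof.
move=> z0; have h : 1 + z + z ^+ 2 / 2 <= expR z.
  have nd : nondecreasing_seq (series (exp_coeff z)).
    apply/nondecreasing_seqP => k; rewrite /series/= big_nat_recr//= lerDl.
    by rewrite /exp_coeff/= divr_ge0// exprn_ge0.
  have := nondecreasing_cvgn_le nd (is_cvg_series_exp_coeff z) 3%N.
  rewrite /series/= !big_nat_recr//= big_geq// add0r /exp_coeff/= expr0 expr1.
  by rewrite !factS fact0 divr1 divr1.
set a := 1 + z + z ^+ 2 / 2 in h.
have a0 : 0 < a by rewrite /a; nra.
have : expR (- z) <= a^-1 by rewrite expRN lef_pV2 ?posrE ?expR_gt0.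
have : 2 * z <= a - a^-1.
  rewrite -(ler_pM2r a0) mulrBl mulVf ?gt_eqF// -subr_ge0.
  have -> : a * a - 1 - 2 * z * a = z ^+ 4 / 4 by rewrite /a; field.
  by rewrite divr_ge0// exprn_ge0.
by move: h; lra.
Qed.

Let sinh_le z : 0 <= z -> expR z - expR (- z) <= 2 * z * expR z.
Proof.
move=> z0; have e3 : expR z * expR (- (2 * z)) = expR (- z).
  by rewrite -expRD; congr expR; ring.
have := ler_wpM2l (expR_ge0 z) (expR_ge1Dx (- (2 * z))).
by rewrite e3; nra.
Qed.

(** exp x + exp (- x) - 2 is the square of exp (x / 2) - exp (- x / 2), and
    sinh z >= z for z >= 0. *)
Lemma cosh_ge x : x ^+ 2 <= expR x + expR (- x) - 2.
Proof.
wlog x0 : x / 0 <= x.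
  move=> h; have [/h//|x0] := leP 0 x; have := h (- x).
  by rewrite sqrrN opprK [expR (- x) + _]addrC; apply; rewrite oppr_ge0 ltW.
rewrite cosh_sqr; have z0 : 0 <= x / 2 by rewrite divr_ge0.
rewrite (_ : x ^+ 2 = (2 * (x / 2)) ^+ 2); last by field.
by apply: lerXn2r; rewrite ?nnegrE ?mulr_ge0// ?(le_trans _ (sinh_ge z0))
  ?mulr_ge0// sinh_ge.
Qed.

Lemma cosh_le x : expR x + expR (- x) - 2 <= x ^+ 2 * expR `|x|.
Proof.
wlog x0 : x / 0 <= x.
  move=> h; have [/h//|x0] := leP 0 x; have := h (- x).
  rewrite sqrrN opprK normrN [expR (- x) + _]addrC; apply.
  by rewrite oppr_ge0 ltW.
rewrite cosh_sqr ger0_norm//; have z0 : 0 <= x / 2 by rewrite divr_ge0.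
have -> : x ^+ 2 * expR x = (2 * (x / 2) * expR (x / 2)) ^+ 2.
  have e1 : expR x = expR (x / 2) ^+ 2.
    by rewrite expr2 -expRD; congr expR; field.
  by rewrite e1; field.
apply: lerXn2r; rewrite ?nnegrE ?mulr_ge0 ?expR_ge0//; last exact: sinh_le.
by rewrite (le_trans _ (sinh_ge z0))// mulr_ge0.
Qed.

(** The second difference of the generating function in th is th^2 times the second
    moment, up to a cubic error that is integrable. *)
Lemma cosh_le_cubic x th : 0 <= th <= 1 ->
  expR (th * x) + expR (- (th * x)) - 2 <=
  th ^+ 2 * x ^+ 2 + th ^+ 3 * (6 * (expR (2 * x) + expR (- 2 * x))).
Proof.
move=> /andP[t0 t1]; apply: le_trans (cosh_le _) _.
set a := `|x|; have a0 : 0 <= a by exact: normr_ge0.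
have -> : `|th * x| = th * a by rewrite normrM ger0_norm.
have e1 : expR (th * a) <= 1 + th * a * expR a.
  have e3 : expR (th * a) * expR (- (th * a)) = 1 by rewrite -expRD subrr expR0.
  have := ler_wpM2l (expR_ge0 (th * a)) (expR_ge1Dx (- (th * a))).
  rewrite e3 => h; apply: (@le_trans _ _ (1 + th * a * expR (th * a))); first lra.
  by rewrite lerD2l ler_wpM2l ?mulr_ge0// ler_expR ler_piMl.
have e2 : a ^+ 3 * expR a <= 6 * expR (2 * a).
  have -> : expR (2 * a) = expR a * expR a by rewrite -expRD; congr expR; ring.
  rewrite mulrA ler_wpM2r ?expR_ge0//.
  have := @expR_ge1Dxn R a 2 a0; rewrite (_ : 3`!%:R = 6 :> R)// => h; lra.
have e4 : expR (2 * a) <= expR (2 * x) + expR (- 2 * x).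
  rewrite /a; have [x0|x0] := ger0P x; first by rewrite lerDl expR_ge0.
  by rewrite mulrN mulNr lerDr expR_ge0.
have := ler_wpM2l (sqr_ge0 (th * x)) e1; move=> /le_trans; apply.
rewrite mulrDr mulr1 exprMn lerD2l -[x ^+ 2]real_normK ?num_real// -/a.
have -> : th ^+ 2 * a ^+ 2 * (th * a * expR a) = th ^+ 3 * (a ^+ 3 * expR a).
  by ring.
by rewrite ler_wpM2l ?exprn_ge0// (le_trans e2)// ler_wpM2l.
Qed.

End cosh.

Section mgf.
Variables (d : measure_display) (T : measurableType d) (R : realType).
Variable P : probability T R.
Variables (U : T -> R) (v : R).
Hypothesis mU : measurable_fun [set: T] (U : T -> R).
Hypothesis v_ge0 : 0 <= v.
Hypothesis mgf : forall th : R,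
  ('E_P[fun t => expR (th * U t)] = (expR (th ^+ 2 * v / 2))%:E)%E.

Let has_exp th : has_mean P (fun t => expR (th * U t)).
Proof.
have [] // := @has_mean_ge0 _ _ _ P (fun t => expR (th * U t))
  (expR (th ^+ 2 * v / 2)).
- apply: measurableT_comp => //; exact: measurable_funM.
- by rewrite (mgf th) lexx.
Qed.

Let mean_exp th : mean P (fun t => expR (th * U t)) = expR (th ^+ 2 * v / 2).
Proof. by rewrite /mean mgf. Qed.

Lemma mgf_has_mean k : has_mean P (fun t => U t ^+ k).
Proof.
apply: (@has_mean_pow _ _ _ P U k k) => //; last by rewrite -addnn leq_addr.
apply: (@has_mean_le _ _ _ P _ (fun t => (k.*2)`!%:R *
  (expR (1 * U t) + expR (-1 * U t)))).
- exact: measurable_funX.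
- move=> t; rewrite ger0_norm ?exprn_even_ge0 ?odd_double//.
  by rewrite mul1r mulN1r even_power_le_expR.
- by apply: has_meanZ; apply: has_meanD.
Qed.

Let has_mean1 : has_mean P U.
Proof. exact: mgf_has_mean 1. Qed.

Let small_mgf th : 0 <= th -> th ^+ 2 * v / 2 <= 1 / 2 ->
  expR (th ^+ 2 * v / 2) <= 1 + th ^+ 2 * v / 2 + 2 * (th ^+ 2 * v / 2) ^+ 2.
Proof.
move=> t0 h; apply: expR_le1Dxx; rewrite ger0_norm//.
by rewrite divr_ge0// mulr_ge0// sqr_ge0.
Qed.

Let squeeze (a b c e : R) : 0 < e ->
  (forall t, 0 < t -> t <= e -> a <= b + t * c) -> a <= b.
Proof.
move=> e0 h; rewrite leNgt; apply/negP => ba.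
pose t := Num.min e ((a - b) / (2 * (`|c| + 1))).
have c1 : 0 < `|c| + 1 by rewrite ltr_wpDl.
have t0 : 0 < t.
  by rewrite lt_min e0 divr_gt0 ?subr_gt0 ?mulr_gt0.
have := h t t0; rewrite ge_min lexx => /(_ isT).
have tc : t * c <= (a - b) / 2.
  apply: (@le_trans _ _ (t * (`|c| + 1))).
    rewrite ler_wpM2l ?(ltW t0)// (le_trans (ler_norm _))// lerDl//.
  have : t <= (a - b) / (2 * (`|c| + 1)) by rewrite ge_min lexx orbT.
  move=> /(ler_wpM2r (ltW c1))/le_trans; apply.
  rewrite le_eqVlt; apply/orP; left; apply/eqP; field.
  by rewrite gt_eqF.
by move: ba; lra.
Qed.

(* below this value the exponent th^2 v / 2 is at most 1 / 2 *)
Let e0 : R := (v + 1)^-1.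

Let e0_gt0 : 0 < e0. Proof. by rewrite invr_gt0 ltr_wpDl. Qed.

Let e0_le1 : e0 <= 1. Proof. by rewrite invf_le1 ?lerDr ?ltr_wpDl. Qed.

Let small t : 0 < t -> t <= e0 -> t ^+ 2 * v / 2 <= 1 / 2.
Proof.
move=> t0 te; have t1 := le_trans te e0_le1.
have : t * (v + 1) <= 1 by rewrite -ler_pdivlMr ?ltr_wpDl// div1r.
by have := mulr_ge0 (ltW t0) v_ge0; nra.
Qed.

(** 1 + th E U <= exp (th^2 v / 2) for th of both signs forces E U = O(th). *)
Lemma mgf_mean1 : mean P U = 0.
Proof.
have key th : 1 + th * mean P U <= expR (th ^+ 2 * v / 2).
  rewrite -mean_exp -(mean_cst P 1) -meanZ// -meanD//; last 2 first.
  - exact: has_mean_cst.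
  - exact: has_meanZ.
  apply: mean_le => //.
    by apply: has_meanD; [exact: has_mean_cst|exact: has_meanZ].
  by move=> t; exact: expR_ge1Dx.
have bound t : 0 < t -> t <= e0 -> t * `|mean P U| <= t * (t * (2 * v)).
  move=> t0 te; have sm := small t0 te; have := small_mgf (ltW t0) sm.
  have := key t; have := key (- t); rewrite sqrrN.
  have : 0 <= t ^+ 2 * v / 2 by rewrite divr_ge0// mulr_ge0// sqr_ge0.
  move=> y0 k1 k2 k3; rewrite -[X in X * `|_|](gtr0_norm t0) -normrM.
  rewrite ler_norml; move: (expR _) k1 k2 k3 => E k1 k2 k3.
  have -> : t * (t * (2 * v)) = 4 * (t ^+ 2 * v / 2) by field.
  by move: (t ^+ 2 * v / 2) y0 sm k3 => y y0 sm k3; apply/andP; split; nra.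
apply/eqP; rewrite -normr_le0; apply: (squeeze (e := e0) (c := 2 * v)) => //.
by move=> t t0 te; rewrite add0r -(ler_pM2l t0) bound.
Qed.

(** E (exp (th U) + exp (- th U) - 2) = 2 exp (th^2 v / 2) - 2 is th^2 v up to
    fourth order, and th^2 E U^2 up to third order. *)
Lemma mgf_mean2 : mean P (fun t => U t ^+ 2) = v.
Proof.
have h2 := mgf_has_mean 2.
have hc th : has_mean P (fun t => expR (th * U t) + expR (- th * U t) + (- 2)).
  by apply: has_meanD; [exact: has_meanD|exact: has_mean_cst].
have mc th : mean P (fun t => expR (th * U t) + expR (- th * U t) + (- 2)) =
    2 * expR (th ^+ 2 * v / 2) - 2.
  rewrite meanD; [|exact: has_meanD|exact: has_mean_cst].
  by rewrite meanD// mean_cst !mean_exp sqrrN; ring.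
apply/eqP; rewrite eq_le; apply/andP; split.
  apply: (squeeze (e := e0) (c := v ^+ 2)) => // t t0 te.
  have sm := small t0 te; have := small_mgf (ltW t0) sm.
  have : t ^+ 2 * mean P (fun t => U t ^+ 2) <= 2 * expR (t ^+ 2 * v / 2) - 2.
    rewrite -mc -meanZ//; apply: mean_le => //; first exact: has_meanZ.
    by move=> u; rewrite -exprMn mulNr; exact: cosh_ge.
  have t1 := le_trans te e0_le1; set E := expR _; set M := mean _ _ => k1 k2.
  have t2 : 0 < t ^+ 2 by rewrite exprn_gt0.
  rewrite -(ler_pM2l t2); apply: le_trans k1 _.
  have : t ^+ 2 * (t ^+ 2 * v ^+ 2) <= t ^+ 2 * (t * v ^+ 2).
    rewrite ler_wpM2l ?(ltW t2)// ler_wpM2r ?sqr_ge0// expr2 ler_piMl ?(ltW t0)//.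
  by move: k2; move: (ltW t0) => ?; lra.
pose B := 6 * (expR (2 ^+ 2 * v / 2) + expR ((- 2) ^+ 2 * v / 2)).
apply: (squeeze (e := e0) (c := B)) => // t t0 te.
have t1 := le_trans te e0_le1.
have : 2 * expR (t ^+ 2 * v / 2) - 2 <=
    t ^+ 2 * mean P (fun t => U t ^+ 2) + t ^+ 3 * B.
  have hB : has_mean P (fun u => t ^+ 3 *
     (6 * (expR (2 * U u) + expR (- 2 * U u)))).
    by do 2 apply: has_meanZ; exact: has_meanD.
  have mB : mean P (fun u => t ^+ 3 *
     (6 * (expR (2 * U u) + expR (- 2 * U u)))) = t ^+ 3 * B.
    by rewrite !meanZ ?meanD ?mean_exp//;
      [exact: has_meanD|apply: has_meanZ; exact: has_meanD].
  rewrite -mc -mB -meanZ// -meanD//; last exact: has_meanZ.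
  apply: mean_le => //; first by apply: has_meanD => //; exact: has_meanZ.
  by move=> u; rewrite [- t * _]mulNr; apply: cosh_le_cubic; rewrite (ltW t0).
have := expR_ge1Dx (t ^+ 2 * v / 2).
set E := expR _; set M := mean _ _ => k1 k2.
have t2 : 0 < t ^+ 2 by rewrite exprn_gt0.
rewrite -(ler_pM2l t2) mulrDr mulrA -exprSr.
by move: k1 k2; lra.
Qed.

End mgf.

(** * Weak limits and uniformly bounded moments *)

(** Truncation to [- M, M], written with absolute values so that its continuity is
    immediate. *)
Definition clamp (R : realType) (M x : R) : R := (`|x + M| - `|x - M|) / 2.

Lemma clamp_id (R : realType) (M x : R) : `|x| <= M -> clamp M x = x.
Proof.
rewrite ler_norml => /andP[h1 h2]; rewrite /clamp ger0_norm; last lra.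
by rewrite ler0_norm; [field|lra].
Qed.

Lemma clamp_le (R : realType) (M x : R) : 0 <= M -> `|clamp M x| <= M.
Proof.
move=> M0; rewrite /clamp normrM [`|2^-1|]ger0_norm// ler_pdivrMr//.
apply: le_trans (ler_dist_dist _ _) _.
rewrite (_ : x + M - (x - M) = M * 2); last by ring.
by rewrite ger0_norm// mulr_ge0.
Qed.

Lemma continuous_clamp (R : realType) (M : R) : continuous (clamp M).
Proof.
move=> x; apply: cvgMl; apply: cvgB; apply: cvg_norm.
  by apply: cvgD; [exact: cvg_id|exact: cvg_cst].
by apply: cvgB; [exact: cvg_id|exact: cvg_cst].
Qed.

(** The two powers differ only where |x| > M, and there |x|^k is at most
    |x|^(2k+2) / M. *)
Lemma clamp_pow_close (R : realType) (M x : R) (k : nat) : 1 <= M ->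
  `|x ^+ k - clamp M x ^+ k| <= 2 / M * x ^+ k.+1.*2.
Proof.
move=> M1; have M0 : 0 < M by lra.
have r0 : 0 <= 2 / M * x ^+ k.+1.*2.
  by rewrite mulr_ge0 ?divr_ge0 ?exprn_even_ge0 ?odd_double// ltW.
have [xM|xM] := leP `|x| M; first by rewrite clamp_id// subrr normr0.
have ev := even_pow_norm x k.+1.
have x1 : 1 <= `|x| by lra.
apply: le_trans (ler_normB _ _) _; rewrite !normrX ev.
have h1 : `|clamp M x| ^+ k <= `|x| ^+ k.
  by apply: lerXn2r; rewrite ?nnegrE// (le_trans (clamp_le _ (ltW M0)))// ltW.
have h2 : M * `|x| ^+ k <= `|x| ^+ k.+1.*2.
  apply: (@le_trans _ _ (`|x| ^+ k.+1)).
    by rewrite exprS ler_wpM2r ?exprn_ge0// ltW.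
  by rewrite ler_weXn2l// -addnn leq_addr.
have : `|x| ^+ k <= `|x| ^+ k.+1.*2 / M by rewrite ler_pdivlMr// mulrC.
move=> h3; rewrite [leRHS](_ : _ = 2 * (`|x| ^+ k.+1.*2 / M)); [move: h1; lra|ring].
Qed.

Lemma bounded_funP (R : realType) (f : R -> R) (M : R) :
  (forall x, `|f x| <= M) -> bounded_fun f.
Proof.
move=> fM; exists M; split; first exact: num_real.
by move=> y My x _ /=; rewrite (le_trans (fM x))// ltW.
Qed.

Lemma bounded_fun_bound (R : realType) (f : R -> R) :
  bounded_fun f -> exists2 M, 0 <= M & forall x, `|f x| <= M.
Proof.
move=> [M [_ h]]; exists (`|M| + 1); first by rewrite addr_ge0.
move=> x; apply: (h (`|M| + 1)) => //.
by rewrite (le_lt_trans (ler_norm M))// ltrDl.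
Qed.

Section weak_limits.
Variables (R : realType).
Variables (d : measure_display) (T : measurableType d) (P : probability T R).
Variables (d' : measure_display) (T' : measurableType d') (P' : probability T' R).
Variables (xi : nat -> T -> R) (zeta : T' -> R).
Hypothesis mxi : forall n, measurable_fun [set: T] (xi n : T -> R).
Hypothesis mzeta : measurable_fun [set: T'] (zeta : T' -> R).
Hypothesis xi_zeta : cvg_in_distribution P xi P' zeta.

Lemma has_mean_cont d1 (T1 : measurableType d1) (P1 : probability T1 R)
    (eta : T1 -> R) (f : R -> R) : measurable_fun [set: T1] (eta : T1 -> R) ->
  continuous f -> bounded_fun f -> has_mean P1 (f \o eta).
Proof.
move=> meta cf /bounded_fun_bound[M M0 fM].
apply: (@has_mean_bounded _ _ _ _ _ M); last by move=> t; exact: fM.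
by apply: measurableT_comp => //; exact: continuous_measurable_fun.
Qed.

Lemma cvg_mean (f : R -> R) : continuous f -> bounded_fun f ->
  mean P (f \o xi n) @[n --> \oo] --> mean P' (f \o zeta).
Proof.
move=> cf bf; have h := xi_zeta cf bf.
apply: fine_cvg; rewrite -meanE; last exact: has_mean_cont.
exact: h.
Qed.

(** Replace the k-th power by its truncation, which is bounded and continuous.  The
    error is at most 2 / M times the moment of order 2k + 2, uniformly in n. *)
Lemma moments_cvg (k : nat) :
  (forall j, has_mean P' (fun t => zeta t ^+ j)) ->
  (forall q, exists M : R, forall n, (1 < n)%N ->
     ('E_P[fun t => (xi n t ^+ q.*2)%R] <= M%:E)%E) ->
  (forall n, (1 < n)%N -> has_mean P (fun t => xi n t ^+ k)) /\
  mean P (fun t => xi n t ^+ k) @[n --> \oo] --> mean P' (fun t => zeta t ^+ k).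
Proof.
move=> hz hM.
have [B hB] := hM k.+1.
have hx n : (1 < n)%N -> has_mean P (fun t => xi n t ^+ k.+1.*2) /\
    mean P (fun t => xi n t ^+ k.+1.*2) <= B.
  move=> n1; apply: has_mean_ge0; last exact: hB.
    exact: measurable_funX.
  by move=> t; rewrite exprn_even_ge0 ?odd_double.
have hxk n : (1 < n)%N -> has_mean P (fun t => xi n t ^+ k).
  move=> n1; apply: (has_mean_pow (k := k.+1)) => //; first by case: (hx n n1).
  by rewrite (leq_trans (leqnSn k))// -addnn leq_addr.
split=> //.
pose C := Num.max B (mean P' (fun t => zeta t ^+ k.+1.*2)).
apply/cvgrPdist_le => e e0.
pose M : R := 1 + 6 * `|C| / e.
have M1 : 1 <= M by rewrite lerDl divr_ge0 ?mulr_ge0// ltW.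
have M0 : 0 < M by rewrite (lt_le_trans ltr01).
have CM : 2 / M * C <= e / 3.
  apply: (@le_trans _ _ (2 / M * `|C|)).
    by rewrite ler_wpM2l ?divr_ge0 ?(ltW M0)// ler_norm.
  rewrite mulrAC ler_pdivrMr// /M mulrDr mulr1.
  rewrite (_ : e / 3 * (6 * `|C| / e) = 2 * `|C|).
    by rewrite lerDr divr_ge0// ltW.
  by field; rewrite gt_eqF.
pose f x := clamp M x ^+ k.
have cf : continuous f.
  by move=> x; apply: (@continuous_comp _ _ _ (clamp M) (fun y : R => y ^+ k));
    [exact: continuous_clamp|exact: exprn_continuous].
have bf : bounded_fun f.
  apply: (@bounded_funP _ _ (M ^+ k)) => x; rewrite normrX.
  by apply: lerXn2r; rewrite ?nnegrE ?(ltW M0)// clamp_le// ltW.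
have close d1 (T1 : measurableType d1) (P1 : probability T1 R) (eta : T1 -> R) :
    measurable_fun [set: T1] (eta : T1 -> R) ->
    has_mean P1 (fun t => eta t ^+ k) ->
    has_mean P1 (fun t => eta t ^+ k.+1.*2) ->
    mean P1 (fun t => eta t ^+ k.+1.*2) <= C ->
    `|mean P1 (fun t => eta t ^+ k) - mean P1 (f \o eta)| <= e / 3.
  move=> meta h1 h2 h3.
  apply: (@mean_close _ _ _ P1 _ _ (fun t => 2 / M * eta t ^+ k.+1.*2)) => //.
  - exact: has_mean_cont.
  - exact: has_meanZ.
  - by move=> t; exact: clamp_pow_close.
  - rewrite meanZ// (le_trans _ CM)// ler_wpM2l// divr_ge0// ltW//.
have c1 := close _ _ P' zeta mzeta (hz k) (hz _).
have {}c1 : `|mean P' (fun t => zeta t ^+ k) - mean P' (f \o zeta)| <= e / 3.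
  by apply: c1; rewrite le_max lexx orbT.
have e30 : 0 < e / 3 by rewrite divr_gt0.
have /cvgrPdist_le/(_ _ e30) c2 := cvg_mean cf bf.
near=> n.
have n1 : (1 < n)%N by near: n; exists 2%N.
have c3 : `|mean P' (f \o zeta) - mean P (f \o xi n)| <= e / 3.
  by near: n; exact: c2.
have [h1 h2] := hx n n1.
have c4 : `|mean P (fun t => xi n t ^+ k) - mean P (f \o xi n)| <= e / 3.
  by apply: close => //; [exact: hxk|rewrite le_max h2].
move: c1 c3 c4; rewrite !ler_norml => /andP[? ?] /andP[? ?] /andP[? ?].
by apply/andP; split; lra.
Unshelve. all: by end_near. Qed.

(** On a compact interval the test function composed with the affine maps converges
    uniformly; outside of it, Chebyshev's inequality and the bound on second moments
    make the contribution small. *)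
Lemma slutsky_affine (a_ b_ : nat -> R) (a b B : R) :
  a_ n @[n --> \oo] --> a -> b_ n @[n --> \oo] --> b ->
  (forall n, (1 < n)%N -> ('E_P[fun t => (xi n t ^+ 2)%R] <= B%:E)%E) ->
  cvg_in_distribution P (fun n t => a_ n * xi n t + b_ n)
    P' (fun t => a * zeta t + b).
Proof.
move=> a_a b_b hB f cf bf.
have [F F0 hF] := bounded_fun_bound bf.
have hx n : (1 < n)%N -> has_mean P (fun t => xi n t ^+ 2) /\
    mean P (fun t => xi n t ^+ 2) <= B.
  move=> n1; apply: has_mean_ge0; last exact: hB.
    exact: measurable_funX.
  by move=> t; rewrite sqr_ge0.
pose g x := f (a * x + b).
have cg : continuous g.
  move=> x; apply: (@continuous_comp _ _ _ (fun x : R => a * x + b) f).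
    by apply: cvgD; [apply: cvgMr; exact: cvg_id|exact: cvg_cst].
  exact: cf.
have bg : bounded_fun g by apply: (@bounded_funP _ _ F) => x; exact: hF.
pose W n t : R := a_ n * xi n t + b_ n.
have mW n : measurable_fun [set: T] (W n : T -> R).
  by apply: measurable_funD => //; apply: measurable_funM.
have -> : (fun n => 'E_P[f \o W n])%E = (fun n => (mean P (f \o W n))%:E).
  by apply/funext => n; rewrite meanE//; exact: has_mean_cont.
have -> : ('E_P'[f \o (fun t => (a * zeta t + b)%R)] =
    (mean P' (g \o zeta))%:E)%E.
  by rewrite -meanE//; exact: has_mean_cont.
apply: cvg_EFin; first exact: nearW.
apply/cvgrPdist_le => e e0.
have e30 : 0 < e / 3 by rewrite divr_gt0.
have /cvgrPdist_le/(_ _ e30) c1 := cvg_mean cg bg.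
pose M : R := 1 + 6 * F * `|B| / e.
have M1 : 1 <= M by rewrite lerDl divr_ge0 ?mulr_ge0// ltW.
have M0 : 0 < M by rewrite (lt_le_trans ltr01).
have BM : 2 * F / M * B <= e / 3.
  apply: (@le_trans _ _ (2 * F / M * `|B|)).
    by rewrite ler_wpM2l ?divr_ge0 ?mulr_ge0 ?(ltW M0)// ler_norm.
  rewrite mulrAC ler_pdivrMr// /M mulrDr mulr1.
  rewrite (_ : e / 3 * (6 * F * `|B| / e) = 2 * F * `|B|).
    by rewrite lerDr divr_ge0// ltW.
  by field; rewrite gt_eqF.
have unif : \forall n \near \oo, `[- M, M] `<=`
    (fun x => `|f (a_ n * x + b_ n) - g x| <= e / 3).
  have /compact_near_coveringP cover := @segment_compact R (- M) M.
  apply: (cover nat \oo (fun n x => `|f (a_ n * x + b_ n) - g x| <= e / 3)) => x _.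
  have lim : f (a_ z.2 * z.1 + b_ z.2) - g z.1 @[z --> (nbhs x, \oo)] --> g x - g x.
    apply: cvgB; last first.
      by apply: (cvg_comp _ _ cvg_fst); exact: cg.
    apply: (@cvg_comp _ _ _ (fun z : R * nat => a_ z.2 * z.1 + b_ z.2) f _
      (nbhs (a * x + b))); last exact: cf.
    apply: cvgD; last by apply: (cvg_comp _ _ cvg_snd); exact: b_b.
    apply: cvgM; first by apply: (cvg_comp _ _ cvg_snd); exact: a_a.
    exact: cvg_fst.
  rewrite subrr in lim; move/cvgrPdist_le/(_ _ e30): lim.
  apply: filterS => -[y n] /=.
  by rewrite sub0r normrN.
near=> n.
have n1 : (1 < n)%N by near: n; exists 2%N.
have [h1 h2] := hx n n1.
have c2 : `|mean P' (g \o zeta) - mean P (g \o xi n)| <= e / 3.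
  by near: n; exact: c1.
have un : `[- M, M] `<=` (fun x => `|f (a_ n * x + b_ n) - g x| <= e / 3).
  by near: n; exact: unif.
have c3 : `|mean P (f \o W n) - mean P (g \o xi n)|
    <= e / 3 + e / 3.
  apply: (@mean_close _ _ _ P _ _ (fun t => e / 3 + 2 * F / M * xi n t ^+ 2)).
  - exact: has_mean_cont.
  - exact: has_mean_cont.
  - by apply: has_meanD; [exact: has_mean_cst|exact: has_meanZ].
  - move=> t /=; have [xM|xM] := leP `|xi n t| M.
      apply: le_trans (un (xi n t) _) _; first by rewrite /= in_itv/= -ler_norml.
      by rewrite lerDl mulr_ge0 ?sqr_ge0// divr_ge0 ?mulr_ge0// ltW.
    apply: le_trans (ler_normB _ _) _.
    apply: le_trans (lerD (hF _) (hF _)) _.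
    apply: (@le_trans _ _ (2 * F / M * xi n t ^+ 2)); last by rewrite lerDr ltW.
    rewrite -(real_normK (num_real (xi n t))).
    have : M <= `|xi n t| ^+ 2 by rewrite expr2; nra.
    move=> h; rewrite mulrAC ler_pdivlMr//.
    have := ler_wpM2l (mulr_ge0 (ler0n _ 2) F0) h; lra.
  - rewrite meanD; [|exact: has_mean_cst|exact: has_meanZ].
    rewrite mean_cst lerD2l meanZ// (le_trans _ BM)// ler_wpM2l//.
    by rewrite divr_ge0 ?mulr_ge0// ltW.
move: c2 c3; rewrite !ler_norml => /andP[? ?] /andP[? ?]; rewrite [(_ \o _) n]/=.
by apply/andP; split; lra.
Unshelve. all: by end_near. Qed.

End weak_limits.

(** * Moments of the rescaled urn *)

(** Makes additive constants negligible against the normalization, from n = 2 on;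
    at n = 0 and n = 1 the normalization may vanish. *)
Lemma nlog_lower (R : realType) (nu : nat) : exists2 l : R, 0 < l &
  forall t, (1 < t)%N -> l <= nlog R nu t.
Proof.
have L2 := ln2_gt0 R.
exists (ln 2 ^+ nu); first exact: exprn_gt0.
move=> t t1; have h : ln 2 ^+ nu <= ln t%:R ^+ nu :> R.
  apply: lerXn2r; rewrite ?nnegrE ?(ltW L2) ?ln_ge_ln2//.
  by rewrite ln_ge0// ler1n ltnW.
apply: (le_trans h); rewrite /nlog ler_peMl ?ler1n ?(ltnW t1)//.
by rewrite exprn_ge0// ln_ge0// ler1n ltnW.
Qed.

Lemma continuous_dotv (R : realType) (s : nat) (w : 'rV[R]_s) :
  continuous (dotv w).
Proof.
suff h (q : seq 'I_s) :
    continuous (fun x : 'rV[R]_s => \sum_(i <- q) w 0 i * x 0 i) by exact: h.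
elim: q => [|i q IH].
  rewrite (_ : (fun _ => _) = cst 0); first exact: cst_continuous.
  by apply/funext => x; rewrite big_nil.
rewrite (_ : (fun _ => _) =
  (fun x : 'rV[R]_s => w 0 i * x 0 i + \sum_(j <- q) w 0 j * x 0 j)); last first.
  by apply/funext => x; rewrite big_cons.
move=> x; apply: (@continuousD R R _ (fun x : 'rV[R]_s => w 0 i * x 0 i)); last exact: IH.
apply: (@continuousM R _ (cst (w 0 i)) (fun x : 'rV[R]_s => x 0 i)).
  exact: cst_continuous.
exact: coord_continuous.
Qed.

Section moments.
Variables (R : realType) (n : nat) (r : 'M[R]_n.+1) (m : R) (x0 : 'rV[R]_n.+1).
Variables (d : measure_display) (T : measurableType d) (P : probability T R).
Variables (X : nat -> T -> 'rV[R]_n.+1) (K : nat -> T -> 'I_n.+1).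
Hypotheses (hX : polya_urn P r x0 X K) (hten : tenable P X).
Hypothesis hcond : tenability_condition r x0.
Hypotheses (m_gt0 : 0 < m) (hbal : balanced r m) (hirr : irreducible_mx r).
Hypothesis hsmall : small_urn r m.
Variable nu : nat.
Hypothesis hnu : urn_exponent r m nu.
Variable v1 : 'rV[R]_n.+1.
Hypotheses (hv1 : v1 *m r = m *: v1) (v1_sum : \sum_i v1 0 i = 1).

Definition scaled_deviation (w : 'rV[R]_n.+1) (t : nat) (x : 'rV[R]_n.+1) : R :=
  (Num.sqrt (nlog R nu t))^-1 * (dotv w x - t%:R * m * dotv w v1).

Let S0 := \sum_j x0 0 j.

Let S0_gt0 : 0 < S0.
Proof. exact: nonneg_nonzero_sum_gt0 (urn_start_nonneg hX). Qed.

Lemma measurable_scaled_deviation w t :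
  measurable_fun [set: T] ((fun z => scaled_deviation w t (X t z)) : T -> R).
Proof. by have [q [p [_ _ _ mX]]] := urn_law hX hten hbal t; exact: mX. Qed.

(** As <1, X_t> is deterministic, the deviation of <w, X_t> is X_t u plus a constant,
    where u = w^T - <w, v1> 1 is orthogonal to v1. *)
Lemma scaled_deviation_moments (w : 'rV[R]_n.+1) (q : nat) :
  exists M : R, forall t, (1 < t)%N ->
    ('E_P[fun z => (scaled_deviation w t (X t z) ^+ q.*2)%R] <= M%:E)%E.
Proof.
pose dv := dotv w v1.
pose u : 'cV[R]_n.+1 := w^T - dv *: const_mx 1.
have vu : v1 *m u = 0.
  apply/matrixP => i j; rewrite !ord1 !mxE.
  under eq_bigr do rewrite !mxE mulr1 mulrBr.
  rewrite sumrB -mulr_suml v1_sum mul1r /dv /dotv.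
  by apply/eqP; rewrite subr_eq0; apply/eqP/eq_bigr => k _; rewrite mulrC.
have [C C0 hC] := propag_square_sum hcond.1 hbal hirr hv1 v1_sum S0_gt0 m_gt0
  hsmall hnu vu.
have [l l0 hl] := nlog_lower R nu.
have L0 t : (1 < t)%N -> 0 < nlog R nu t.
  by move=> t1; rewrite (lt_le_trans l0)// hl.
have [M hM] := urn_even_moments hX hten hbal C0 hC L0 q.
pose b : R := (`|dv * S0| / Num.sqrt l) ^+ q.*2.
exists (2 ^+ q.*2 * (M + b)) => t t1.
pose A (x : 'rV[R]_n.+1) : R := (((x *m u) 0 0 / Num.sqrt (nlog R nu t)) ^+ q.*2).
have [_ [_ [_ _ _ mX]]] := urn_law hX hten hbal t.
have [hA mA] : has_mean P (A \o X t) /\ mean P (A \o X t) <= M.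
  apply: has_mean_ge0; last exact: hM.
    exact: mX.
  by move=> z; rewrite /A/= exprn_even_ge0 ?odd_double.
apply: (@le_trans _ _ ('E_P[(fun x => (2 ^+ q.*2 * (A x + b))%R) \o X t])%E).
  apply: (@urn_mean_le _ _ _ _ _ _ _ P X K hX hten hbal t
    (fun x => scaled_deviation w t x ^+ q.*2) (fun x => 2 ^+ q.*2 * (A x + b))) => x _ xS.
  rewrite /scaled_deviation; set L := nlog R nu t; have sL : 0 < Num.sqrt L.
    by rewrite sqrtr_gt0 L0.
  have -> : (Num.sqrt L)^-1 * (dotv w x - t%:R * m * dotv w v1) =
      (x *m u) 0 0 / Num.sqrt L + dv * S0 / Num.sqrt L.
    rewrite -mulrDl mulrC; congr (_ / _).
    rewrite mulmxBr -scalemxAr !mxE.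
    under [X in _ - dv * X + _]eq_bigr do rewrite mxE mulr1.
    rewrite xS -/dv -/S0 /dotv.
    rewrite [X in _ = X - _ + _](eq_bigr (fun j => w 0 j * x 0 j)).
      by ring.
    by move=> j _; rewrite mxE mulrC.
  apply: le_trans (even_powerD_le _ _ _) _.
  rewrite ler_wpM2l ?exprn_ge0// lerD2l /b.
  rewrite -[leLHS]ger0_norm ?exprn_even_ge0 ?odd_double// normrX.
  apply: lerXn2r; rewrite ?nnegrE// ?divr_ge0 ?sqrtr_ge0//.
  rewrite normrM [`|_^-1|]ger0_norm ?invr_ge0 ?(ltW sL)//.
  by rewrite ler_wpM2l// lef_pV2 ?posrE// ?sqrtr_gt0// ler_wsqrtr// hl.
have hb : has_mean P (fun z => A (X t z) + b).
  by apply: has_meanD => //; exact: has_mean_cst.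
rewrite meanE; last exact: has_meanZ.
rewrite lee_fin [X in mean P X](_ : _ = fun z => 2 ^+ q.*2 * (A (X t z) + b))//.
rewrite meanZ// meanD//; last exact: has_mean_cst.
by rewrite mean_cst ler_wpM2l ?exprn_ge0// lerD2r.
Qed.

End moments.

(** * The limiting normal vector *)

Section gaussian_vector.
Variables (d : measure_display) (T : measurableType d) (R : realType).
Variables (P : probability T R) (s : nat) (Z : T -> 'rV[R]_s) (Sigma : 'M[R]_s).
Hypothesis hZ : centred_normal_vector P Z Sigma.

Lemma measurable_dotvZ (w : 'rV[R]_s) :
  measurable_fun [set: T] ((fun t => dotv w (Z t)) : T -> R).
Proof.
have [mZ _ _] := hZ.
by apply: measurable_sum => i; apply: measurable_funM => //; exact: mZ.
Qed.

Let dotvZ_mgf (w : 'rV[R]_s) : exists v : R, [/\ 0 <= v,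
   forall th : R, ('E_P[fun t => expR (th * dotv w (Z t))] =
     (expR (th ^+ 2 * v / 2))%:E)%E &
   forall B : set R, measurable B ->
          P [set t | B (dotv w (Z t))] = centred_normal_law v B].
Proof.
have [_ /(_ w)[v v0 lawZ] _] := hZ; exists v; split => // th.
exact: (law_mgf (measurable_dotvZ w) v0 lawZ).
Qed.

Lemma dotvZ_has_mean w k : has_mean P (fun t => dotv w (Z t) ^+ k).
Proof.
have [v [v0 hmgf _]] := dotvZ_mgf w.
exact: (mgf_has_mean (measurable_dotvZ w) hmgf).
Qed.

Lemma dotvZ_mean1 w : mean P (fun t => dotv w (Z t)) = 0.
Proof.
have [v [v0 hmgf _]] := dotvZ_mgf w.
exact: (mgf_mean1 (measurable_dotvZ w) v0 hmgf).
Qed.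

Let coordE i t : Z t 0 i = dotv (delta_mx 0 i) (Z t).
Proof.
rewrite /dotv (bigD1 i)//= mxE !eqxx mul1r big1 ?addr0// => j ji.
by rewrite mxE (negbTE ji) mul0r.
Qed.

Let has_meanZZ i j : has_mean P (fun t => Z t 0 i * Z t 0 j).
Proof.
have [mZ _ _] := hZ.
apply: (@has_mean_le _ _ _ P _ (fun t => Z t 0 i ^+ 2 + Z t 0 j ^+ 2)).
- by apply: measurable_funM; exact: mZ.
- move=> t; rewrite ler_norml; move: (Z t 0 i) (Z t 0 j) => x y.
  by have := sqr_ge0 (x - y); have := sqr_ge0 (x + y); have := sqr_ge0 x;
     have := sqr_ge0 y => *; apply/andP; split; nra.
- by apply: has_meanD; under eq_fun do rewrite coordE; exact: dotvZ_has_mean.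
Qed.

Let has_mean_coord i : has_mean P (fun t => Z t 0 i).
Proof.
rewrite (_ : (fun _ => _) = (fun t => dotv (delta_mx 0 i) (Z t) ^+ 1)).
  exact: dotvZ_has_mean.
by apply/funext => t; rewrite expr1 coordE.
Qed.

Let mean_coord i : mean P (fun t => Z t 0 i) = 0.
Proof.
rewrite -[RHS](dotvZ_mean1 (delta_mx 0 i)); congr mean.
by apply/funext => t; rewrite coordE.
Qed.

Let meanZZ i j : mean P (fun t => Z t 0 i * Z t 0 j) = Sigma i j.
Proof.
have [_ _ /(_ i j)] := hZ; rewrite covarianceE; last 3 first.
- exact/Lfun1_integrable/has_mean_coord.
- exact/Lfun1_integrable/has_mean_coord.
- exact/Lfun1_integrable/has_meanZZ.
rewrite !(meanE (has_mean_coord _)) !mean_coord mule0 sube0.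
by rewrite (meanE (has_meanZZ i j)) => -[].
Qed.

Lemma dotvZ_mean2 w :
  mean P (fun t => dotv w (Z t) ^+ 2) = (w *m Sigma *m w^T) 0 0.
Proof.
transitivity (\sum_i \sum_j w 0 i * w 0 j * Sigma i j); last first.
  rewrite mxE exchange_big/=; apply: eq_bigr => j _.
  rewrite mxE mulr_suml; apply: eq_bigr => i _; rewrite mxE; ring.
transitivity (mean P (fun t => \sum_i \sum_j w 0 i * w 0 j * (Z t 0 i * Z t 0 j))).
  congr mean; apply/funext => t; rewrite expr2 /dotv mulr_suml.
  apply: eq_bigr => i _; rewrite mulr_sumr; apply: eq_bigr => j _; ring.
rewrite mean_sum; last by move=> i; apply: has_mean_sum => j; exact: has_meanZ.
apply: eq_bigr => i _; rewrite mean_sum; last by move=> j; exact: has_meanZ.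
by apply: eq_bigr => j _; rewrite meanZ// meanZZ.
Qed.

(** The variance parameter of the normal law of <w, Z> is its second moment, which
    the covariance matrix computes because the coordinates are centred. *)
Lemma dotvZ_law w : let v := (w *m Sigma *m w^T) 0 0 in
  0 <= v /\ forall B : set R, measurable B ->
          P [set t | B (dotv w (Z t))] = centred_normal_law v B.
Proof.
have [v [v0 hmgf lawv]] := dotvZ_mgf w.
by rewrite /= -dotvZ_mean2 (mgf_mean2 (measurable_dotvZ w) v0 hmgf).
Qed.

End gaussian_vector.

Section standard_normal.
Variable R : realType.

Lemma std_normal_has_mean k :
  has_mean (normal_prob (0 : R) 1) (fun x : R => x ^+ k).
Proof.
apply: (@mgf_has_mean _ _ _ (normal_prob (0 : R) 1) id 1).
  exact: measurable_id.
by move=> th; rewrite unlock normal_mgf ?oner_eq0// expr1n.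
Qed.

End standard_normal.

(** Adding a constant makes the test function nonnegative, so that the integrals may
    be rewritten without integrability conditions. *)
Lemma mean_standardized (d : measure_display) (T : measurableType d)
    (R : realType) (P : probability T R) (U : T -> R) (v : R) (f : R -> R) :
  measurable_fun [set: T] (U : T -> R) -> 0 < v ->
  (forall B : set R, measurable B ->
     P [set t | B (U t)] = centred_normal_law v B) ->
  continuous f -> bounded_fun f ->
  mean P (fun t => f (U t / Num.sqrt v)) = mean (normal_prob (0 : R) 1) f.
Proof.
move=> mU v0 lawU cf bf; have [F F0 hF] := bounded_fun_bound bf.
pose g x := f x + F.
have g0 x : 0 <= g x by have := hF x; rewrite ler_norml => /andP[]; rewrite /g; lra.
have cg : continuous g by move=> x; apply: cvgD; [exact: cf|exact: cvg_cst].
have s0 : 0 < Num.sqrt v by rewrite sqrtr_gt0.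
pose h x := g (x / Num.sqrt v).
have ch : continuous h.
  move=> x; apply: (@continuous_comp _ _ _ (fun x : R => x / Num.sqrt v) g).
    by apply: cvgMl; exact: cvg_id.
  exact: cg.
have hf1 : has_mean P (fun t => f (U t / Num.sqrt v)).
  apply: (@has_mean_bounded _ _ _ _ _ F); last by move=> t; exact: hF.
  apply: (measurableT_comp (continuous_measurable_fun cf)).
  exact: measurable_funM.
have hf2 : has_mean (normal_prob (0 : R) 1) f.
  apply: (@has_mean_bounded _ _ _ _ _ F); last by move=> t; exact: hF.
  exact: continuous_measurable_fun.
have key : (\int[P]_t (h (U t))%:E = \int[normal_prob (0 : R) 1]_x (g x)%:E)%E.
  rewrite (ge0_integral_law mU lawU); last 2 first.
  - exact: continuous_measurable_fun.
  - by move=> x; exact: g0.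
  rewrite (gt_eqF v0); exact: (normal_scale s0 cg g0).
apply: (addIr F).
have e1 : mean P (fun t => f (U t / Num.sqrt v)) + F = mean P (fun t => h (U t)).
  by rewrite -{1}(mean_cst P F) -meanD//; exact: has_mean_cst.
have e2 : mean (normal_prob (0 : R) 1) f + F = mean (normal_prob (0 : R) 1) g.
  by rewrite -{1}(mean_cst (normal_prob (0 : R) 1) F) -meanD//; exact: has_mean_cst.
by rewrite e1 e2 /mean unlock key.
Qed.

(** * Standardization and the theorem *)

Lemma variance_mean (d : measure_display) (T : measurableType d) (R : realType)
    (P : probability T R) (U : T -> R) :
  has_mean P U -> has_mean P (fun t => U t ^+ 2) ->
  fine 'V_P[U]%E = mean P (fun t => U t ^+ 2) - mean P U ^+ 2.
Proof.
move=> h1 h2.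
have e : U * U = (fun t => U t ^+ 2) by apply/funext => t; rewrite expr2.
rewrite /variance covarianceE; last 3 first.
- exact/Lfun1_integrable.
- exact/Lfun1_integrable.
- by apply/Lfun1_integrable; rewrite e.
by rewrite e !meanE// -EFinM -EFinB.
Qed.

Lemma cvgn_bounded (R : realType) (u : nat -> R) (l : R) :
  u n @[n --> \oo] --> l -> exists2 M, 0 <= M & forall n, `|u n| <= M.
Proof.
move=> ul; have : cvgn u by apply/cvg_ex; exists l.
move=> /cvg_seq_bounded [M [_ h]]; exists (`|M| + 1); first by rewrite addr_ge0.
move=> n; apply: (h (`|M| + 1)) => //.
by rewrite (le_lt_trans (ler_norm M))// ltrDl.
Qed.

Section standardization.
Variables (R : realType).
Variables (d : measure_display) (T : measurableType d) (P : probability T R).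
Variables (d' : measure_display) (T' : measurableType d') (P' : probability T' R).
Variables (xi : nat -> T -> R) (zeta : T' -> R) (g : R).
Hypothesis mxi : forall n, measurable_fun [set: T] (xi n : T -> R).
Hypothesis mzeta : measurable_fun [set: T'] (zeta : T' -> R).
Hypothesis xi_zeta : cvg_in_distribution P xi P' zeta.
Hypothesis g_gt0 : 0 < g.
Hypothesis zeta_law : forall B : set R, measurable B ->
  P' [set t | B (zeta t)] = centred_normal_law g B.
Hypothesis xi_moments : forall q, exists M : R, forall n, (1 < n)%N ->
  ('E_P[fun t => (xi n t ^+ q.*2)%R] <= M%:E)%E.
Variables (a_ b_ : nat -> R).
Hypothesis a_cvg : a_ n @[n --> \oo] --> (Num.sqrt g)^-1.
Hypothesis b_cvg : b_ n @[n --> \oo] --> 0.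

Lemma affine_cvg_normal :
  cvg_in_distribution P (fun n t => a_ n * xi n t + b_ n)
    (normal_prob (0 : R) 1) id.
Proof.
have [M2 hM2] := xi_moments 1.
have sl := slutsky_affine mxi mzeta xi_zeta a_cvg b_cvg hM2.
move=> f cf bf; have := sl f cf bf.
rewrite (_ : 'E_P'[_] = 'E_(normal_prob (0 : R) 1)[f \o id])%E//.
have [F F0 hF] := bounded_fun_bound bf.
have hf2 : has_mean (normal_prob (0 : R) 1) f.
  apply: (@has_mean_bounded _ _ _ _ _ F); last by move=> t; exact: hF.
  exact: continuous_measurable_fun.
have hf1 : has_mean P' (fun t => f (zeta t / Num.sqrt g)).
  apply: (@has_mean_bounded _ _ _ _ _ F); last by move=> t; exact: hF.
  apply: (measurableT_comp (continuous_measurable_fun cf)).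
  exact: measurable_funM.
rewrite [RHS](meanE hf2) -(mean_standardized mzeta g_gt0 zeta_law cf bf).
rewrite -meanE//; congr ('E_P'[_])%E; apply/funext => t /=.
by rewrite addr0 mulrC.
Qed.

Lemma affine_moments_cvg k :
  (forall n, (1 < n)%N -> has_mean P (fun t => (a_ n * xi n t + b_ n) ^+ k)) /\
  mean P (fun t => (a_ n * xi n t + b_ n) ^+ k) @[n --> \oo] -->
    mean (normal_prob (0 : R) 1) (fun x : R => x ^+ k).
Proof.
apply: (@moments_cvg _ _ _ P _ _ (normal_prob (0 : R) 1)
  (fun n t => a_ n * xi n t + b_ n) id).
- by move=> n; apply: measurable_funD => //; apply: measurable_funM.
- exact: measurable_id.
- exact: affine_cvg_normal.
- by move=> j; exact: std_normal_has_mean.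
move=> q; have [M hM] := xi_moments q.
have [A A0 hA] := cvgn_bounded a_cvg.
have [B B0 hB] := cvgn_bounded b_cvg.
exists (2 ^+ q.*2 * (A ^+ q.*2 * M + B ^+ q.*2)) => n n1.
have [h1 h2] : has_mean P (fun t => xi n t ^+ q.*2) /\
    mean P (fun t => xi n t ^+ q.*2) <= M.
  apply: has_mean_ge0; last exact: hM.
    exact: measurable_funX.
  by move=> z; rewrite exprn_even_ge0 ?odd_double.
pose D t := A ^+ q.*2 * xi n t ^+ q.*2 + B ^+ q.*2.
have hD : has_mean P D.
  by apply: has_meanD; [exact: has_meanZ|exact: has_mean_cst].
have pt t : (a_ n * xi n t + b_ n) ^+ q.*2 <= 2 ^+ q.*2 * D t.
  apply: le_trans (even_powerD_le _ _ _) _.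
  rewrite ler_wpM2l ?exprn_ge0// lerD//.
    rewrite exprMn ler_wpM2r ?exprn_even_ge0 ?odd_double// even_pow_norm.
    by apply: lerXn2r; rewrite ?nnegrE.
  by rewrite even_pow_norm; apply: lerXn2r; rewrite ?nnegrE.
have hW : has_mean P (fun t => (a_ n * xi n t + b_ n) ^+ q.*2).
  apply: (@has_mean_le _ _ _ _ _ (fun t => 2 ^+ q.*2 * D t)).
  - by apply: measurable_funX; apply: measurable_funD => //; apply: measurable_funM.
  - by move=> t; rewrite ger0_norm// exprn_even_ge0 ?odd_double.
  - exact: has_meanZ.
rewrite meanE// lee_fin.
apply: (@le_trans _ _ (mean P (fun t => 2 ^+ q.*2 * D t))).
  by apply: mean_le => //; exact: has_meanZ.
rewrite meanZ// ler_wpM2l ?exprn_ge0// meanD; [|exact: has_meanZ|exact: has_mean_cst].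
by rewrite mean_cst lerD2r meanZ// ler_wpM2l// exprn_ge0.
Qed.

End standardization.

Theorem corollary1p3 (R : realType) (s : nat) (r : 'M[R]_s) (m : R)
    (x0 : 'rV[R]_s)
    (d : measure_display) (T : measurableType d) (P : probability T R)
    (X : nat -> T -> 'rV[R]_s) (K : nat -> T -> 'I_s)
    (hX : polya_urn P r x0 X K)
    (hten : tenable P X) (hcond : tenability_condition r x0)
    (m_gt0 : 0 < m) (hbal : balanced r m) (hirr : irreducible_mx r)
    (hsmall : small_urn r m)
    (nu : nat) (hnu : urn_exponent r m nu)
    (v1 : 'rV[R]_s) (hv1 : v1 *m r = m *: v1)
    (v1_gt0 : forall i, 0 < v1 0 i) (v1_norm : \sum_(i < s) `|v1 0 i| = 1)
    (Sigma : 'M[R]_s)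
    (d' : measure_display) (T' : measurableType d') (P' : probability T' R)
    (Z : T' -> 'rV[R]_s) (hZ : centred_normal_vector P' Z Sigma)
    (hlim : cvg_in_distribution P
       (fun n t => (Num.sqrt (nlog R nu n))^-1 *: (X n t - (n%:R * m) *: v1))
       P' Z)
    (w : 'rV[R]_s) :
  let Y := fun n t => dotv w (X n t) in
  let EY := fun n => fine 'E_P[Y n]%E in
  let VarY := fun n => fine 'V_P[Y n]%E in
  let gamma := (w *m Sigma *m w^T) 0 0 in
  [/\ EY = (fun n => n%:R * m * dotv w v1)
             +o_\oo (fun n => Num.sqrt (nlog R nu n)),
      exists2 eps : nat -> R, eps n @[n --> \oo] --> 0 &
        \forall n \near \oo, VarY n = (gamma + eps n) * nlog R nu n &
      gamma != 0 ->
        let W := fun n t => (Y n t - EY n) / Num.sqrt (VarY n) in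
        cvg_in_distribution P W (normal_prob (0 : R) 1) id /\
        forall k : nat, ('E_P[fun t => (W n t ^+ k)%R] @[n --> \oo] -->
          'E_(normal_prob (0 : R) 1)[fun x : R => (x ^+ k)%R])%E].
Proof.
move=> Y EY VarY gamma.
case: s r x0 X K hX hten hcond hbal hirr hsmall hnu v1 hv1 v1_gt0 v1_norm
  Sigma Z hZ hlim w @Y @EY @VarY @gamma => [|s] r x0 X K hX hten hcond hbal hirr
  hsmall hnu v1 hv1 v1_gt0 v1_norm Sigma Z hZ hlim w Y EY VarY gamma.
  by move: v1_norm; rewrite big_ord0 => /eqP; rewrite eq_sym oner_eq0.
have v1_sum : \sum_i v1 0 i = 1.
  by rewrite -v1_norm; apply: eq_bigr => i _; rewrite gtr0_norm.
pose L n := nlog R nu n; pose dv := dotv w v1.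
pose xi n t := scaled_deviation m nu v1 w n (X n t).
pose zeta t := dotv w (Z t).
have mxi n : measurable_fun [set: T] (xi n : T -> R).
  exact: (measurable_scaled_deviation hX hten hbal nu v1 w n).
have mzeta : measurable_fun [set: T'] (zeta : T' -> R) := measurable_dotvZ hZ w.
have xi_moments := scaled_deviation_moments hX hten hcond m_gt0 hbal hirr hsmall hnu
  hv1 v1_sum w.
have xi_zeta : cvg_in_distribution P xi P' zeta.
  move=> f cf bf.
  have cfw : continuous (f \o dotv w).
    move=> x; apply: continuous_comp; [exact: continuous_dotv|exact: cf].
  have bfw : bounded_fun (f \o dotv w).
    have [F F0 hF] := bounded_fun_bound bf.
    exists F; split; first exact: num_real.
    by move=> y Fy x _ /=; rewrite (le_trans (hF _))// ltW.
  have := hlim _ cfw bfw.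
  rewrite (_ : (fun n => _) = (fun n => 'E_P[f \o xi n])%E)//.
  apply/funext => n; congr ('E_P[_])%E; apply/funext => t /=; congr f.
  rewrite /xi /scaled_deviation /dotv mulr_sumr -sumrB mulr_sumr.
  apply: eq_bigr => i _; rewrite !mxE; ring.
have Zpow k := dotvZ_has_mean hZ w k.
have mom k := moments_cvg mxi mzeta xi_zeta k Zpow xi_moments.
have xi1 n : (1 < n)%N -> has_mean P (xi n).
  by move=> n1; have := (mom 1%N).1 n n1; under eq_fun do rewrite expr1.
have xi2 n : (1 < n)%N -> has_mean P (fun t => xi n t ^+ 2) := (mom 2%N).1 n.
have mean1 : mean P (xi n) @[n --> \oo] --> 0.
  have := (mom 1%N).2; rewrite -(dotvZ_mean1 hZ w).
  rewrite (_ : (fun n => _) = (fun n => mean P (xi n))); last first.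
    by apply/funext => n; congr mean; apply/funext => t; rewrite expr1.
  rewrite (_ : (fun t => zeta t ^+ 1) = zeta); first exact.
  by apply/funext => t; rewrite expr1.
have mean2 : mean P (fun t => xi n t ^+ 2) @[n --> \oo] --> gamma.
  by rewrite /gamma -(dotvZ_mean2 hZ w); exact: (mom 2%N).2.
have [l l0 hl] := nlog_lower R nu.
have L0 n : (1 < n)%N -> 0 < L n by move=> n1; rewrite (lt_le_trans l0)// hl.
pose sL n := Num.sqrt (L n).
have sL0 n : (1 < n)%N -> 0 < sL n by move=> n1; rewrite sqrtr_gt0 L0.
have sLsq n : (1 < n)%N -> sL n ^+ 2 = L n by move=> n1; rewrite sqr_sqrtr// ltW// L0.
have YE n t : (1 < n)%N -> Y n t = sL n * xi n t + n%:R * m * dv.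
  move=> n1; rewrite /xi /scaled_deviation -/(L n) -/(sL n) -/dv mulrA divff
    ?mul1r ?subrK//.
  by rewrite gt_eqF// sL0.
have EYE n : (1 < n)%N -> EY n = sL n * mean P (xi n) + n%:R * m * dv.
  move=> n1; rewrite /EY -/(mean P (Y n)).
  rewrite (_ : Y n = (fun t => sL n * xi n t + n%:R * m * dv)).
    rewrite meanD; [|by apply: has_meanZ; exact: xi1|exact: has_mean_cst].
    by rewrite mean_cst meanZ//; exact: xi1.
  by apply/funext => t; exact: YE.
pose vn n := mean P (fun t => xi n t ^+ 2) - mean P (xi n) ^+ 2.
have vn_cvg : vn n @[n --> \oo] --> gamma.
  have -> : vn = (fun n => mean P (fun t => xi n t ^+ 2) -
      mean P (xi n) * mean P (xi n)) by apply/funext => n; rewrite -expr2.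
  have -> : gamma = gamma - 0 * 0 by rewrite mulr0 subr0.
  by apply: cvgB => //; exact: cvgM.
have VarYE n : (1 < n)%N -> VarY n = vn n * L n.
  move=> n1; rewrite /VarY.
  have Y1 : has_mean P (Y n).
    rewrite (_ : Y n = (fun t => sL n * xi n t + n%:R * m * dv)).
      by apply: has_meanD; [apply: has_meanZ; exact: xi1|exact: has_mean_cst].
    by apply/funext => t; exact: YE.
  pose c := n%:R * m * dv.
  have Y2E : (fun t => Y n t ^+ 2) =
      (fun t => L n * xi n t ^+ 2 + (2 * sL n * c * xi n t + c ^+ 2)).
    by apply/funext => t; rewrite YE// -/c -sLsq//; ring.
  have hA : has_mean P (fun t => L n * xi n t ^+ 2) by apply: has_meanZ; exact: xi2.
  have hB : has_mean P (fun t => 2 * sL n * c * xi n t).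
    by apply: has_meanZ; exact: xi1.
  have hC : has_mean P (fun t => 2 * sL n * c * xi n t + c ^+ 2).
    by apply: has_meanD => //; exact: has_mean_cst.
  rewrite variance_mean//; last by rewrite Y2E; exact: has_meanD.
  rewrite Y2E meanD// meanD//; last exact: has_mean_cst.
  rewrite mean_cst (meanZ _ (xi2 n n1)) (meanZ _ (xi1 n n1)).
  have -> : mean P (Y n) = sL n * mean P (xi n) + c by exact: EYE.
  by rewrite /vn -sLsq//; ring.
split.
- apply/eqaddoP => e e0.
  have /cvgrPdist_le/(_ _ e0) h := mean1.
  near=> n; have n1 : (1 < n)%N by near: n; exists 2%N.
  have hn : `|0 - mean P (xi n)| <= e by near: n; exact: h.
  rewrite [X in `|X|](_ : _ = sL n * mean P (xi n)); last first.
    by rewrite !fctE EYE// addrK.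
  rewrite normrM mulrC ler_wpM2r//.
  by move: hn; rewrite sub0r normrN.
- exists (fun n => vn n - gamma).
    by rewrite -[X in _ --> X](subrr gamma); apply: cvgB => //; exact: cvg_cst.
  near=> n; have n1 : (1 < n)%N by near: n; exists 2%N.
  by rewrite VarYE// addrC subrK.
move=> gamma0 W.
have [g_ge0 lawg] := dotvZ_law hZ w.
have g0 : 0 < gamma by rewrite lt_neqAle eq_sym gamma0.
have sg0 : 0 < Num.sqrt gamma by rewrite sqrtr_gt0.
(* [vn] is the variance of the rescaled variable, so [a_] and [b_] standardize it *)
pose a_ n := (Num.sqrt (vn n))^-1; pose b_ n := - mean P (xi n) / Num.sqrt (vn n).
have a_cvg : a_ n @[n --> \oo] --> (Num.sqrt gamma)^-1.
  apply: cvgV; first by rewrite gt_eqF.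
  exact: (cvg_comp _ _ vn_cvg (@sqrt_continuous R gamma)).
have b_cvg : b_ n @[n --> \oo] --> 0.
  rewrite -(mul0r (Num.sqrt gamma)^-1) -oppr0.
  by apply: cvgM => //; exact: cvgN.
have WE n : (1 < n)%N -> W n = (fun t => a_ n * xi n t + b_ n).
  move=> n1; apply/funext => t; rewrite /W YE// EYE// VarYE//.
  rewrite [vn n * _]mulrC sqrtrM ?(ltW (L0 _ n1))// -/(sL n) /a_ /b_ invfM.
  have h : sL n * (sL n)^-1 = 1 by rewrite divff// gt_eqF// sL0.
  transitivity (sL n * (sL n)^-1 *
    ((xi n t - mean P (xi n)) * (Num.sqrt (vn n))^-1)); first by ring.
  by rewrite h; ring.
split.
  move=> f cf bf.
  have := affine_cvg_normal mxi mzeta xi_zeta g0 lawg xi_moments a_cvg b_cvg cf bf.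
  apply: cvg_trans; apply: near_eq_cvg; near=> n.
  by rewrite WE//; near: n; exists 2%N.
move=> k.
have [hW cW] := affine_moments_cvg mxi mzeta xi_zeta g0 lawg xi_moments
  a_cvg b_cvg k.
rewrite (meanE (std_normal_has_mean R k)).
suff : (mean P (fun t => (a_ n * xi n t + b_ n) ^+ k))%:E @[n --> \oo] -->
    (mean (normal_prob (0 : R) 1) (fun x : R => x ^+ k))%:E.
  apply: cvg_trans; apply: near_eq_cvg; near=> n.
  have n1 : (1 < n)%N by near: n; exists 2%N.
  rewrite -meanE; last exact: hW.
  by congr ('E_P[_])%E; apply/funext => t; rewrite (WE n n1).
by apply: cvg_EFin => //; exact: nearW.
Unshelve. all: by end_near. Qed.
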